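(* Let $s$ and $n$ be positive integers with $n\ge 4s$. Let $\mathcal{H}$ be a Berge-triangle-free $4$-graph with $n$ vertices and $\nu(\mathcal{H})\le s$. Then $$|E(\mathcal{H})|\le s\left\lfloor\frac{n-2s}{2}\right\rfloor$$ unless $s=1$ and $4\mid (n-1)$, in which case $|E(\mathcal{H})|\le\frac{n-1}{2}$. Equality holds if $\mathcal{H}=\mathcal{H}_4(s,n)$. When $\nu(\mathcal{H})>2$ and $2\mid n$, equality holds if and only if $\mathcal{H}=\mathcal{H}_4(s,n)$ (up to isomorphism).
   Context: A $4$-graph $\mathcal{H}$ consists of a finite vertex set $V(\mathcal{H})$ and an edge set $E(\mathcal{H})\subseteq\binom{V(\mathcal{H})}{4}$. The matching number $\nu(\mathcal{H})$ is the maximum number of pairwise disjoint edges of $\mathcal{H}$. A Berge-$K_3$ (Berge triangle) consists of three distinct edges $e_1,e_2,e_3$ for which there are three distinct vertices $x,y,z$ with $\{x,y\}\subseteq e_1$, $\{y,z\}\subseteq e_2$, $\{x,z\}\subseteq e_3$; $\mathcal{H}$ is Berge-triangle-free if it contains no such three edges. For $n\ge 4s$ the $4$-graph $\mathcal{H}_4(s,n)$ on $n$ vertices is defined as follows; write $[m]=\{1,\dots,m\}$ and $[a,b]=\{a,a+1,\dots,b\}$ (empty if $b<a$). Case $s=1$: write $n=4k+l+1$ with $k,l$ nonnegative integers, $0\le l<4$. The vertices are $a_1,b_1,\dots,b_{4k+l}$. The edges are $\{a_1,b_{4i+1},b_{4i+2},b_{4i+3}\}$ and $\{a_1,b_{4i+2},b_{4i+3},b_{4i+4}\}$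 for $i\in[0,k-1]$, together with, if $4\mid n$, the additional edge $\{a_1,b_{4k+1},b_{4k+2},b_{4k+3}\}$. Case $s\ge2$: vertices $v_1,\dots,v_{2s},u_1,\dots,u_{n-2s}$ and edges $\{v_{2i-1},v_{2i},u_{2j-1},u_{2j}\}$ for $i\in[s]$, $j\in\left[\left\lfloor\frac{n-2s}{2}\right\rfloor\right]$. *)

(* Defs.v *)
From mathcomp Require Import all_boot.

Set Implicit Arguments.
Unset Strict Implicit.
Unset Printing Implicit Defensive.

(** A hypergraph on the vertex set [T] is given by its edge set
    [E : {set {set T}}]; in particular there are no repeated edges. *)

Section Hypergraph.

Variable T : finType.
Implicit Types (E M : {set {set T}}) (e : {set T}).

Definition four_graph E : Prop := forall e, e \in E -> #|e| = 4.

Definition matching E M : bool := (M \subset E) && trivIset M.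

Definition matching_number E : nat := \max_(M | matching E M) #|M|.

Definition berge_triangle e1 e2 e3 : Prop :=
  [/\ e1 != e2, e2 != e3 & e1 != e3] /\
  exists x y z : T,
    [/\ x != y, y != z & x != z] /\
    [/\ [set x; y] \subset e1, [set y; z] \subset e2 & [set x; z] \subset e3].

Definition berge_triangle_free E : Prop :=
  ~ exists e1 e2 e3,
      [/\ e1 \in E, e2 \in E & e3 \in E] /\ berge_triangle e1 e2 e3.

End Hypergraph.

Definition isomorphic (T U : finType)
    (E : {set {set T}}) (F : {set {set U}}) : Prop :=
  exists2 f : T -> U, bijective f & [set f @: e | e : {set T} in E] = F.

Definition label_set (n : nat) (l : seq nat) : {set 'I_n} :=
  [set x : 'I_n | val x \in l].

(** The case [s = 1], with [a_1] numbered [0] and [b_m] numbered [m]; here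
    [k = (n - 1) %/ 4] is the quotient in [n = 4k + l + 1], [0 <= l < 4]. *)
Definition H4_one (n : nat) : {set {set 'I_n}} :=
  let k := (n - 1) %/ 4 in
  [set label_set n [:: 0; 4 * i + 1; 4 * i + 2; 4 * i + 3] | i : 'I_k]
  :|: [set label_set n [:: 0; 4 * i + 2; 4 * i + 3; 4 * i + 4] | i : 'I_k]
  :|: (if 4 %| n
       then [set label_set n [:: 0; 4 * k + 1; 4 * k + 2; 4 * k + 3]]
       else set0).

(** The case [s >= 2], with [v_m] numbered [m - 1] and [u_m] numbered
    [2s + m - 1]; the indices [i] and [j] are shifted to start at [0]. *)
Definition H4_many (s n : nat) : {set {set 'I_n}} :=
  [set label_set n [:: 2 * i; 2 * i + 1; 2 * s + 2 * j; 2 * s + 2 * j + 1]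
    | i : 'I_s, j : 'I_((n - 2 * s) %/ 2)].

Definition H4 (s n : nat) : {set {set 'I_n}} :=
  if s == 1 then H4_one n else H4_many s n.

Definition edge_bound (s n : nat) : nat :=
  if (s == 1) && (4 %| n - 1) then (n - 1) %/ 2
  else s * ((n - 2 * s) %/ 2).

(* Main.v *)
(* Call two edges partners when they share three vertices. Berge-triangle-freeness
   forces every third edge to meet the union of two partners in at most one
   vertex. Fix an edge e and let D be the set of edges that meet e, other than e
   and its partner. Two edges of D meet outside e only if they meet e in the same
   single vertex; hence, when every vertex z outside e gives weight 1/d(z) to each
   of the d(z) edges of D through z, every edge of D collects at least 2. So the
   number deg(e) of edges meeting e, itself included, satisfies
   2 deg(e) + 2 <= n + [e has a partner]. Deleting e together with the edges that
   meet it lowers the matching number and reduces n by 4, so the bound follows by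
   induction on s; only n = 1 mod 4 needs care, where deg(e) may exceed
   (n - 2) / 2 by one.

   If n is even and the bound is attained, equality holds at every deletion. For
   s = 2 a pair of partners then forces n = 8, and for s = 3, hence for all s >= 3,
   it is impossible. Without partners the equality case of the weight count says
   that intersecting edges share exactly two vertices and that every vertex lies in
   an edge meeting e. The vertices then split into pairs, the edges are the joins of
   a complete bipartite graph on these pairs, and counting gives the side sizes s and
   (n - 2s) / 2. *)
Require Import Defs.
From mathcomp Require Import all_boot all_order all_algebra.
From mathcomp Require Import zify lra.

Set Implicit Arguments.
Unset Strict Implicit.
Unset Printing Implicit Defensive.

Import Order.TTheory GRing.Theory Num.Theory.

(** * Tame families, partners, and the edges near a fixed edge *)

Definition tame (T : finType) (E : {set {set T}}) : Prop :=
  four_graph E /\ berge_triangle_free E.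

Definition partners (T : finType) (e f : {set T}) : bool :=
  (e != f) && (#|e :&: f| == 3).

Definition touching (T : finType) (E : {set {set T}}) (e : {set T}) :=
  [set h in E | h :&: e != set0].

Definition away (T : finType) (E : {set {set T}}) (e : {set T}) :=
  [set h in E | h :&: e == set0].

Definition loose (T : finType) (E : {set {set T}}) (e : {set T}) :=
  [set h in touching E e | (h != e) && ~~ partners e h].

Definition has_partner (T : finType) (E : {set {set T}}) (e : {set T}) :=
  [exists f in E, partners e f].

Definition reach (T : finType) (E : {set {set T}}) (e : {set T}) :=
  cover (touching E e).

Section Partners.

Variables (T : finType) (E : {set {set T}}).
Hypothesis tameE : tame E.
Implicit Types (e f g h k : {set T}) (x y z u v w : T).

Lemma card_edge e : e \in E -> #|e| = 4.
Proof. by case: tameE => + _; apply. Qed.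

Lemma no_triangle e1 e2 e3 x y z :
  e1 \in E -> e2 \in E -> e3 \in E -> e1 != e2 -> e2 != e3 -> e1 != e3 ->
  x != y -> y != z -> x != z ->
  x \in e1 -> y \in e1 -> y \in e2 -> z \in e2 -> x \in e3 -> z \in e3 -> False.
Proof.
case: tameE => _ tf E1 E2 E3 n12 n23 n13 xy yz xz x1 y1 y2 z2 x3 z3; apply: tf.
exists e1, e2, e3; split=> //; split=> //; exists x, y, z; split=> //.
by split; apply/subsetP => w; rewrite !inE => /orP[] /eqP->.
Qed.

Lemma partnersC e f : partners e f = partners f e.
Proof. by rewrite /partners eq_sym setIC. Qed.

Lemma partners_neq e f : partners e f -> e != f.
Proof. by case/andP. Qed.

Lemma card_edgesI e f : e \in E -> f \in E -> e != f -> #|e :&: f| <= 3.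
Proof.
move=> eE fE nef; rewrite leqNgt; apply/negP => c4.
have He : e :&: f = e by apply/eqP; rewrite eqEcard subsetIl (card_edge eE).
have Hf : e :&: f = f by apply/eqP; rewrite eqEcard subsetIr (card_edge fE).
by move: nef; rewrite -{1}He Hf eqxx.
Qed.

Lemma partners_diff e f : e \in E -> partners e f -> exists d, e :\: f = [set d].
Proof.
move=> eE /andP[_ /eqP c3]; apply/cards1P/eqP.
by have := cardsID f e; rewrite (card_edge eE) c3; clear; lia.
Qed.

(** If [g] met [e] in [a] and [f] in [b] with [a] different from [b], one of the three vertices of
    [e :&: f] would avoid both and close a triangle on [e], [f], [g]. This is the main tool against
    partners below. *)
Lemma partners_sep e f g u v : e \in E -> f \in E -> g \in E ->
  partners e f -> g != e -> g != f -> u \in g -> v \in g ->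
  u \in e :|: f -> v \in e :|: f -> u = v.
Proof.
move=> eE fE gE pef nge ngf ug vg.
have nef := partners_neq pef.
suff main a b : a \in g -> b \in g -> a \in e -> b \in f -> a = b.
  have pfe : partners f e by rewrite partnersC.
  (* When both vertices lie in the same edge, either one of them is common to [e] and [f], so that
     [main] applies, or both are the single vertex left outside the other edge. *)
  rewrite !inE => /orP[ue|uf] /orP[ve|vf]; last 1 first.
  - have [d dP] := partners_diff fE pfe.
    case: (boolP (u \in e)) => ue; first exact: main.
    case: (boolP (v \in e)) => ve; first by apply/esym/main.
    have: u \in f :\: e by rewrite inE ue.
    have: v \in f :\: e by rewrite inE ve.
    by rewrite dP !inE => /eqP-> /eqP->.
  - have [d dP] := partners_diff eE pef.
    case: (boolP (v \in f)) => vf; first exact: main.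
    case: (boolP (u \in f)) => uf; first by apply/esym/main.
    have: u \in e :\: f by rewrite inE uf.
    have: v \in e :\: f by rewrite inE vf.
    by rewrite dP !inE => /eqP-> /eqP->.
  - exact: main.
  - exact/esym/main.
move=> ag bg ae bf; apply/eqP/negPn/negP => nab.
have: 0 < #|(e :&: f) :\: [set a; b]|.
  have := cardsID [set a; b] (e :&: f); have /andP[_ /eqP->] := pef.
  have := subset_leq_card (subsetIr (e :&: f) [set a; b]).
  by rewrite cards2 nab; clear; lia.
case/card_gt0P => w; rewrite !inE negb_or => /andP[/andP[wa wb] /andP[we wf]].
apply: (@no_triangle e f g a w b) => //; by rewrite eq_sym.
Qed.

(** A second partner [g] would meet [e :|: f] in three vertices. *)
Lemma partner_uniq e f g : e \in E -> f \in E -> g \in E ->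
  partners e f -> partners e g -> f = g.
Proof.
move=> eE fE gE pef peg; apply/eqP/negPn/negP => nfg.
have /andP[neg /eqP c3] := peg.
have [u [v [+ + uv]]] : exists u v, [/\ u \in e :&: g, v \in e :&: g & u != v].
  have /card_gt1P[u [v [? ? ?]]] : 1 < #|e :&: g| by rewrite c3.
  by exists u, v.
rewrite !inE => /andP[ue ug] /andP[ve vg].
case/eqP: uv; apply: (partners_sep eE fE gE pef) => //.
- by rewrite eq_sym.
- by rewrite eq_sym.
- by rewrite inE ue.
by rewrite inE ve.
Qed.

(** Otherwise [x], [y], [z] form a triangle carried by [e], [k], [h]. *)
Lemma meet_outside e h k x y z : e \in E -> h \in E -> k \in E ->
  h != e -> k != e -> h != k -> x \in h -> x \in e -> y \in k -> y \in e ->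
  z \in h -> z \in k -> z \notin e -> x = y.
Proof.
move=> eE hE kE nhe nke nhk xh xe yk ye zh zk ze.
apply/eqP/negPn/negP => nxy.
have zx : x != z by apply: contraNneq ze => <-.
have zy : y != z by apply: contraNneq ze => <-.
by apply: (@no_triangle e k h x y z) => //; rewrite eq_sym.
Qed.

Lemma looseP e h : e \in E -> h \in loose E e ->
  [/\ h \in E, h != e, h :&: e != set0 & #|h :&: e| = 1 \/ #|h :&: e| = 2].
Proof.
move=> eE; rewrite !inE => /andP[/andP[hE he] /andP[nhe np]]; split => //.
have := card_edgesI hE eE nhe; move: np he.
rewrite /partners eq_sym nhe /= setIC -cards_eq0; clear; lia.
Qed.

End Partners.

(** * Weights *)

Section Discharging.

Variables (T : finType) (E : {set {set T}}) (e : {set T}).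
Hypotheses (tameE : tame E) (eE : e \in E).
Implicit Types (f g h k : {set T}) (x y z u v w : T).

Definition share z := #|[set h in loose E e | z \in h]|.

(** Each vertex outside [e] splits one unit equally among the loose edges through it; [weight h] is
    what [h] collects. *)
Definition weight h : rat := (\sum_(z in h :\: e) (share z)%:R^-1)%R.

Lemma card_outside h : h \in E -> #|h :\: e| = 4 - #|h :&: e|.
Proof. by move=> hE; rewrite cardsD (card_edge tameE hE). Qed.

(** By [meet_outside], every vertex of [h :&: e] equals every vertex of [k :&: e], so both traces
    are the same singleton. *)
Lemma loose_meet h k z : h \in loose E e -> k \in loose E e -> h != k ->
  z \in h -> z \in k -> z \notin e ->
  exists2 x, h :&: e = [set x] & k :&: e = [set x].
Proof.
move=> hD kD nhk zh zk ze.
have [hE nhe he _] := looseP tameE eE hD.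
have [kE nke ke _] := looseP tameE eE kD.
have same x y : x \in h :&: e -> y \in k :&: e -> x = y.
  rewrite !inE => /andP[xh xe] /andP[yk ye].
  exact: (meet_outside tameE eE hE kE nhe nke nhk xh xe yk ye zh zk ze).
have [x xI] := set0Pn _ he; have [y yI] := set0Pn _ ke.
have exy := same _ _ xI yI; exists x; apply/setP => w; rewrite [RHS]in_set1.
  by apply/idP/eqP => [wI|->//]; rewrite exy (same _ _ wI yI).
apply/idP/eqP => [wI|->]; first exact/esym/same.
by rewrite exy.
Qed.

Lemma share_gt0 h z : h \in loose E e -> z \in h -> 0 < share z.
Proof. by move=> hD zh; apply/card_gt0P; exists h; rewrite inE hD. Qed.

Lemma share1 h z : h \in loose E e -> z \in h ->
  (forall k, k \in loose E e -> z \in k -> k = h) -> share z = 1.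
Proof.
move=> hD zh uniq_h; apply/eqP/cards1P; exists h; apply/setP => k.
rewrite [LHS]inE [RHS]inE; apply/andP/eqP => [[kD zk]|->//]; exact: uniq_h.
Qed.

Lemma shareP h z : h \in loose E e -> z \in h -> share z = 1 \/
  exists k, [/\ k \in loose E e, z \in k & k != h].
Proof.
move=> hD zh.
have [/existsP[k /and3P[]]|] :=
    boolP [exists k, [&& k \in loose E e, z \in k & k != h]].
  by right; exists k.
rewrite negb_exists => /forallP none; left; apply: (share1 hD zh) => k kD zk.
by have := none k; rewrite kD zk negbK => /eqP.
Qed.

(** A trace of two vertices rules out, by [loose_meet], a second loose edge through either of the
    two outer vertices, so each gives its full unit. *)
Lemma weight_pair h : h \in loose E e -> #|h :&: e| = 2 -> weight h = 2%R.
Proof.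
move=> hD c2; have [hE _ _ _] := looseP tameE eE hD.
have := card_outside hE; rewrite c2 => c2'.
rewrite /weight (eq_bigr (fun=> 1%R)) ?sumr_const ?c2' // => z.
rewrite inE => /andP[ze zh].
have [->|[k [kD zk nkh]]] := shareP hD zh; first by rewrite invr1.
have [x _ hx] := loose_meet kD hD nkh zk zh ze.
by move: c2; rewrite hx cards1.
Qed.

Lemma loose_single_pair h k z : h \in loose E e -> k \in loose E e -> k != h ->
  z \in h -> z \in k -> z \notin e -> #|h :&: k| != 3 -> h :&: k :\: e = [set z].
Proof.
move=> hD kD nkh zh zk ze n3.
have [hE nhe he _] := looseP tameE eE hD.
have [kE nke ke _] := looseP tameE eE kD.
have [x hx kx] := loose_meet kD hD nkh zk zh ze.
have := card_edgesI tameE hE kE; rewrite eq_sym => /(_ nkh) le3.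
apply/eqP; rewrite eq_sym eqEcard cards1 sub1set !inE zh zk ze /=.
have xI : x \in h :&: k :&: e.
  have: x \in h :&: e by rewrite kx set11.
  have: x \in k :&: e by rewrite hx set11.
  by rewrite !inE => /andP[-> _] /andP[-> ->].
have : 0 < #|h :&: k :&: e| by apply/card_gt0P; exists x.
have := cardsID e (h :&: k); move/eqP: n3 le3; clear; lia.
Qed.

(** Of the three outer vertices at most one is shared with another loose edge. The other two give
    one each, and the third gives something positive. *)
Lemma weight_single h : h \in loose E e -> #|h :&: e| = 1 ->
  (forall k, k \in loose E e -> ~~ partners h k) -> (2 < weight h)%R.
Proof.
move=> hD c1 nop; have [hE nhe _ _] := looseP tameE eE hD.
have := card_outside hE; rewrite c1 => c3.
(* Suppose that [z] and [w] are both shared, with [k] and [k']. If these coincide, [h] and [k] have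
   two outer vertices in common besides the one in [e], so they are partners. Otherwise [x], [z],
   [w] form a triangle on [k], [h], [k']. *)
have at_most_one z w : z \in h :\: e -> w \in h :\: e -> z != w ->
    share z != 1 -> share w = 1.
  rewrite !inE => /andP[ze zh] /andP[we wh] nzw sz.
  have [//|[k' [kD' wk' nkh']]] := shareP hD wh.
  have [/eqP|[k [kD zk nkh]]] := shareP hD zh; first by rewrite (negPf sz).
  have n3 : #|h :&: k| != 3 by have := nop k kD; rewrite /partners eq_sym nkh.
  have [kE _ _ _] := looseP tameE eE kD.
  have [kE' _ _ _] := looseP tameE eE kD'.
  have [ekk|nkk] := eqVneq k k'.
    have /setP/(_ w) := loose_single_pair hD kD nkh zh zk ze n3.
    by rewrite !inE we wh ekk wk' eq_sym (negPf nzw).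
  have [x hx kx] := loose_meet hD kD (ltac:(by rewrite eq_sym)) zh zk ze.
  have [y hy ky] := loose_meet hD kD' (ltac:(by rewrite eq_sym)) wh wk' we.
  have exy : x = y by apply/set1P; rewrite -hy hx set11.
  have : x \in h :&: e by rewrite hx set11.
  have : x \in k :&: e by rewrite kx set11.
  have : x \in k' :&: e by rewrite ky exy set11.
  rewrite !inE => /andP[xk' xe] /andP[xk _] /andP[xh _].
  have xz : x != z by apply: contraNneq ze => <-.
  have xw : x != w by apply: contraNneq we => <-.
  by case: (@no_triangle _ _ tameE k h k' x z w) => //; rewrite eq_sym.
have [/existsP[z /andP[zD sz]]|] :=
    boolP [exists z, (z \in h :\: e) && (share z != 1)]; last first.
  rewrite negb_exists => /forallP none.
  rewrite /weight (eq_bigr (fun=> 1%R)) ?sumr_const ?c3 // => z zD.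
  by have := none z; rewrite zD /= negbK => /eqP->; rewrite invr1.
rewrite /weight (bigD1 z) //= (eq_bigr (fun=> 1%R)) => [|w /andP[wD nwz]]; last first.
  by rewrite (at_most_one z w) ?invr1 // eq_sym.
rewrite sumr_const.
have -> : #|[pred i | (i \in h :\: e) && (i != z)]| = 2.
  have := cardD1 z [in h :\: e]; rewrite zD c3.
  rewrite (_ : #|[predD1 _ & z]| = #|[pred i | (i \in h :\: e) && (i != z)]|).
    by clear; lia.
  by apply: eq_card => w; rewrite !inE andbC.
rewrite ltrDr invr_gt0 ltr0n (share_gt0 hD) //.
by move: zD; rewrite inE => /andP[].
Qed.

(** The vertex of [h] outside [k] belongs to no other loose edge and gives one; the two outer
    vertices common to [h] and [k] are shared by these two edges only and give one half each. *)
Lemma weight_partner h k : h \in loose E e -> #|h :&: e| = 1 ->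
  k \in loose E e -> partners h k -> (2 <= weight h)%R.
Proof.
move=> hD c1 kD phk; have [hE nhe _ _] := looseP tameE eE hD.
have [kE nke _ _] := looseP tameE eE kD.
have := card_outside hE; rewrite c1 => c3.
have [d dP] := partners_diff tameE hE phk.
have nhk := partners_neq phk.
have [z0 z0I] : exists z, z \in h :&: k :\: e.
  apply/card_gt0P; have := cardsID e (h :&: k); have /andP[_ /eqP->] := phk.
  have : h :&: k :&: e \subset h :&: e by rewrite setSI ?subsetIl.
  by move/subset_leq_card; rewrite c1; clear; lia.
move: z0I; rewrite !inE => /and3P[z0e z0h z0k].
have [x hx kx] := loose_meet hD kD nhk z0h z0k z0e.
have : x \in h :&: e by rewrite hx set11.
have : x \in k :&: e by rewrite kx set11.
rewrite !inE => /andP[xk xe] /andP[xh _].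
(* A third loose edge [g] through [z] would also contain the common trace [x], hence meet [h :|: k]
   twice, against [partners_sep]. *)
have only g z : g \in loose E e -> z \in h -> z \notin e -> z \in g ->
    (g == h) || (g == k).
  move=> gD zh ze zg; apply/negPn/negP; rewrite negb_or => /andP[ngh ngk].
  have [gE _ _ _] := looseP tameE eE gD.
  have [y gy hy] := loose_meet gD hD ngh zg zh ze.
  have exy : x = y by apply/set1P; rewrite -hy hx set11.
  have: x \in g :&: e by rewrite gy exy set11.
  rewrite inE => /andP[xg _].
  have xz : x = z.
    by apply: (partners_sep tameE hE kE gE phk) => //; rewrite inE ?xh ?zh.
  by rewrite -xz xe in ze.
have sub2 z : z \in h :\: e -> (2^-1 <= (share z)%:R^-1 :> rat)%R.
  rewrite !inE => /andP[ze zh]; have sg := share_gt0 hD zh.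
  rewrite lef_pV2 ?posrE ?ltr0n // (ler_nat _ _ 2).
  apply: leq_trans (_ : #|[set h; k]| <= _); last by rewrite cards2 nhk.
  apply/subset_leq_card/subsetP => g; rewrite inE => /andP[gD zg].
  by rewrite !inE; apply: only gD zh ze zg.
have dD : d \in h :\: e.
  have : d \in h :\: k by rewrite dP set11.
  rewrite !inE => /andP[dk ->]; rewrite andbT.
  apply: contra dk => de; suff -> : d = x by [].
  apply/set1P; rewrite -hx inE de andbT.
  by have : d \in h :\: k by [rewrite dP set11]; rewrite inE => /andP[].
have sd : share d = 1.
  have := dD; rewrite inE => /andP[de dh]; apply: (share1 hD dh) => g gD dg.
  have /orP[/eqP//|/eqP egk] := only g d gD dh de dg.
  by have := set11 d; rewrite -dP inE -egk dg.
rewrite /weight (bigD1 d) //= sd invr1.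
have c2 : #|[pred i | (i \in h :\: e) && (i != d)]| = 2.
  have := cardD1 d [in h :\: e]; rewrite dD c3.
  rewrite (_ : #|[predD1 _ & d]| = #|[pred i | (i \in h :\: e) && (i != d)]|).
    by clear; lia.
  by apply: eq_card => w; rewrite !inE andbC.
have : (\sum_(i in [pred i | (i \in h :\: e) && (i != d)]) 2^-1 <=
  \sum_(i in h :\: e | i != d) (share i)%:R^-1 :> rat)%R.
  by apply: ler_sum => z /andP[zD _]; exact: sub2.
rewrite sumr_const c2; clear; lra.
Qed.

(** What equality in the weight count says about [h]. *)
Definition settled h := (#|h :&: e| == 2) ||
  [exists k in E, partners h k && (h :&: e == k :&: e)].

Lemma weight_ge2 h : h \in loose E e -> (2 <= weight h)%R.
Proof.
move=> hD; have [hE nhe _ [c1|c2]] := looseP tameE eE hD; last first.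
  by rewrite weight_pair.
have [/existsP[k /andP[kD phk]]|] := boolP [exists k in loose E e, partners h k].
  exact: weight_partner hD c1 kD phk.
rewrite negb_exists_in => /forall_inP nop; exact/ltW/weight_single.
Qed.

(** A loose partner of [h] shares an outer vertex with it, hence has the same trace on [e], and
    would make [h] settled. So [weight_single] applies. *)
Lemma weight_gt2 h : h \in loose E e -> ~~ settled h -> (2 < weight h)%R.
Proof.
move=> hD; rewrite negb_or => /andP[n2 nop].
have [hE nhe _ [c1|c2]] := looseP tameE eE hD; last by rewrite c2 in n2.
apply: weight_single => // k kD; apply: contra nop => phk.
have [kE _ _ _] := looseP tameE eE kD.
apply/existsP; exists k; rewrite kE phk /=.
have [z zI] : exists z, z \in h :&: k :\: e.
  apply/card_gt0P; have := cardsID e (h :&: k); have /andP[_ /eqP->] := phk.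
  have : h :&: k :&: e \subset h :&: e by rewrite setSI ?subsetIl.
  by move/subset_leq_card; rewrite c1; clear; lia.
move: zI; rewrite !inE => /and3P[ze zh zk].
by have [x -> ->] := loose_meet hD kD (partners_neq phk) zh zk ze.
Qed.

(** Double counting: a covered vertex outside [e] hands out [share z] portions of size one over
    [share z]. *)
Lemma sum_weight :
  (\sum_(h in loose E e) weight h = #|cover (loose E e) :\: e|%:R)%R.
Proof.
rewrite /weight (exchange_big_dep [in cover (loose E e) :\: e]) /=; last first.
  move=> h z hD; rewrite !inE => /andP[-> zh] /=.
  by apply/bigcupP; exists h.
rewrite -sum1_card natr_sum; apply: eq_bigr => z.
rewrite inE => /andP[ze /bigcupP[h hD zh]].
rewrite (eq_bigl [in [set h in loose E e | z \in h]]); last first.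
  by move=> k; rewrite !inE ze.
rewrite sumr_const -/(share z) -[LHS]mulr_natr mulVf //.
by rewrite pnatr_eq0 -lt0n (share_gt0 hD).
Qed.

Lemma loose_cover_ge : 2 * #|loose E e| <= #|cover (loose E e) :\: e|.
Proof.
rewrite -(ler_nat rat) -sum_weight natrM mulr_natr -sumr_const.
exact/ler_sum/weight_ge2.
Qed.

Lemma loose_cover_gt h : h \in loose E e -> ~~ settled h ->
  2 * #|loose E e| < #|cover (loose E e) :\: e|.
Proof.
move=> hD nsh; rewrite -(ltr_nat rat) -sum_weight natrM mulr_natr -sumr_const.
rewrite (bigD1 h) //= [ltRHS](bigD1 h) //= ltr_leD ?weight_gt2 //.
by apply: ler_sum => k /andP[kD _]; exact: weight_ge2.
Qed.

(** * The degree of an edge against the vertices it reaches *)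

Definition deg := #|touching E e|.

Lemma loose_touching h : h \in loose E e -> h \in touching E e.
Proof. by rewrite inE => /andP[]. Qed.

Lemma touching_self : e \in touching E e.
Proof.
by rewrite inE eE setIid -card_gt0 (card_edge tameE eE).
Qed.

Lemma partner_touching f : f \in E -> partners e f -> f \in touching E e.
Proof.
by move=> fE /andP[_ /eqP c3]; rewrite inE fE setIC -card_gt0 c3.
Qed.

Lemma no_partner_touching : ~~ has_partner E e ->
  touching E e = e |: loose E e.
Proof.
rewrite negb_exists_in => /forall_inP nop; apply/setP => h; rewrite in_setU1.
have [->|nhe] := eqVneq h e; first by rewrite touching_self.
rewrite [in RHS]inE nhe /=; case hT: (h \in touching E e) => //=.
by rewrite nop //; move: hT; rewrite inE => /andP[].
Qed.

Lemma partner_touchingE f : f \in E -> partners e f ->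
  touching E e = e |: (f |: loose E e).
Proof.
move=> fE pef; apply/setP => h; rewrite !in_setU1.
have [->|nhe] := eqVneq h e; first by rewrite touching_self.
have [->|nhf] := eqVneq h f; first by rewrite partner_touching.
rewrite [in RHS]inE nhe /=; case hT: (h \in touching E e) => //=.
apply/esym/negP => peh; have hE : h \in E by move: hT; rewrite inE => /andP[].
by move: nhf; rewrite (partner_uniq tameE eE fE hE pef peh) eqxx.
Qed.

Lemma e_notin_loose : e \notin loose E e.
Proof. by rewrite inE eqxx andbF. Qed.

Lemma partner_notin_loose f : partners e f -> f \notin loose E e.
Proof. by move=> pef; rewrite inE pef !andbF. Qed.

Lemma deg_no_partner : ~~ has_partner E e -> deg = #|loose E e|.+1.
Proof.
by move=> np; rewrite /deg no_partner_touching // cardsU1 e_notin_loose.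
Qed.

Lemma deg_partner : has_partner E e -> deg = #|loose E e|.+2.
Proof.
case/exists_inP => f fE pef; rewrite /deg (partner_touchingE fE pef).
rewrite cardsU1 cardsU1 (partner_notin_loose pef) in_setU1.
by rewrite (negPf (partners_neq pef)) (negPf e_notin_loose).
Qed.

(** A partner contributes one further vertex [d]. No loose edge contains [d], since such an edge
    also meets [e] and would meet the union of the two partners twice. *)
Lemma reach_card :
  #|cover (loose E e) :\: e| + 4 + has_partner E e <= #|reach E e|.
Proof.
have sub h : h \in touching E e -> h \subset reach E e.
  by move=> hT; apply: (bigcup_max h).
have subD : cover (loose E e) :\: e \subset reach E e.
  apply/subsetP => z; rewrite inE => /andP[_ /bigcupP[h hD zh]].
  exact: (subsetP (sub h (loose_touching hD))).
have dis : [disjoint cover (loose E e) :\: e & e].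
  by rewrite disjoint_sym disjoints_subset setCD subsetUr.
have subU : cover (loose E e) :\: e :|: e \subset reach E e.
  by rewrite subUset subD sub // touching_self.
have cU : #|cover (loose E e) :\: e :|: e| = #|cover (loose E e) :\: e| + 4.
  move: dis; rewrite -setI_eq0 cardsU => /eqP->.
  by rewrite cards0 subn0 (card_edge tameE eE).
rewrite -cU; have [/exists_inP[f fE pef]|_] := boolP (has_partner E e); last first.
  by rewrite addn0 subset_leq_card.
have pfe : partners f e by rewrite partnersC.
have [d dP] := partners_diff tameE fE pfe.
have : d \in f :\: e by rewrite dP set11.
rewrite inE => /andP[de df].
have dN : d \notin cover (loose E e) :\: e :|: e.
  rewrite !inE (negPf de) orbF /=; apply/negP => /bigcupP[h hD dh].
  have [hE nhe /set0Pn[x]] := looseP tameE eE hD; rewrite inE => /andP[xh xe] _.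
  have nhf : h != f.
    by apply: contraTneq hD => ->; rewrite partner_notin_loose.
  move: de; suff <- : x = d by rewrite xe.
  by apply: (partners_sep tameE eE fE hE pef) => //; rewrite inE ?xe ?df ?orbT.
rewrite addn1 -[X in X.+1]/(_) -add1n.
have := cardsU1 d (cover (loose E e) :\: e :|: e); rewrite dN => <-.
apply: subset_leq_card; rewrite subUset subU sub1set andbT.
exact: subsetP (sub f (partner_touching fE pef)) _ df.
Qed.

(** A partner counts twice on the left but brings only one new vertex; the term [has_partner E e]
    makes up the difference. *)
Lemma deg_reach : 2 * deg + 2 <= #|reach E e| + has_partner E e.
Proof.
have := reach_card; have := loose_cover_ge.
have [hp|np] := boolP (has_partner E e).
  by rewrite (deg_partner hp) /=; clear; lia.
by rewrite (deg_no_partner np) /=; clear; lia.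
Qed.

Lemma deg_reach_settled h : h \in loose E e ->
  #|reach E e| + has_partner E e <= 2 * deg + 2 -> settled h.
Proof.
move=> hD; have := reach_card; have := loose_cover_gt hD.
case: (settled h) => // /(_ isT) A B C; exfalso; move: A B C.
have [hp|np] := boolP (has_partner E e).
  by rewrite (deg_partner hp) /=; clear; lia.
by rewrite (deg_no_partner np) /=; clear; lia.
Qed.

End Discharging.

(** * The upper bound *)

Lemma even_card_involution (X : finType) (f : X -> X) (A : {set X}) :
  (forall x, x \in A -> [/\ f x \in A, f x != x & f (f x) = x]) -> ~~ odd #|A|.
Proof.
have [m] := ubnP #|A|; elim: m => // m IHm in A *; rewrite ltnS => leA fA.
have [->|[x xA]] := set_0Vmem A; first by rewrite cards0.
have [fxA nfx ffx] := fA x xA.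
have c2 : #|A| = #|A :\ x :\ f x|.+2.
  by rewrite (cardsD1 x A) xA (cardsD1 (f x) (A :\ x)) !inE nfx fxA.
rewrite c2 /= negbK; apply: IHm; first by move: leA; rewrite c2; clear; lia.
move=> y; rewrite !inE => /and3P[nyfx nyx yA].
have [fyA nfy ffy] := fA y yA; rewrite nfy fyA ffy andbT; split=> //.
apply/andP; split; last by apply: contraNneq nyfx => <-; rewrite ffy.
by apply: contraNneq nyx => eqf; rewrite -ffy eqf ffx.
Qed.

(** The bound on the matching number stated without the maximum; [nu_leP] proves the equivalence. *)
Definition nu_le (T : finType) (E : {set {set T}}) (s : nat) : Prop :=
  forall M, matching E M -> #|M| <= s.

Section Families.

Variable T : finType.
Implicit Types (E S M : {set {set T}}) (e f g h k V : {set T}) (u v w x y : T).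

Lemma tameS E S : S \subset E -> tame E -> tame S.
Proof.
move=> /subsetP sSE [E4 tf]; split=> [e /sSE/E4//|].
move=> [e1 [e2 [e3 [[i1 i2 i3] tri]]]]; apply: tf.
by exists e1, e2, e3; rewrite !sSE.
Qed.

Lemma away_sub E e : away E e \subset E.
Proof. by apply/subsetP => h; rewrite inE => /andP[]. Qed.

Lemma touching_sub E e : touching E e \subset E.
Proof. by apply/subsetP => h; rewrite inE => /andP[]. Qed.

Lemma card_touching_away E e : #|E| = deg E e + #|away E e|.
Proof.
rewrite -(cardsID (touching E e) E); congr (_ + _).
  by apply: eq_card => h; rewrite !inE andbA andbb.
by apply: eq_card => h; rewrite !inE; case: (h \in E) => //=; rewrite negbK andbT.
Qed.

Lemma tame_away E e : tame E -> tame (away E e).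
Proof. exact/tameS/away_sub. Qed.

Lemma away_disjoint E e h : h \in away E e -> [disjoint e & h].
Proof. by rewrite inE setIC setI_eq0 => /andP[]. Qed.

Lemma cover_away E e V : cover E \subset V -> cover (away E e) \subset V :\: e.
Proof.
move=> /subsetP sV; apply/subsetP => x /bigcupP[h hA xh]; rewrite inE.
rewrite sV ?andbT; last first.
  by apply/bigcupP; exists h => //; exact: subsetP (away_sub E e) h hA.
apply/negP => xe; move/disjoint_setI0/setP/(_ x): (away_disjoint hA).
by rewrite !inE xe xh.
Qed.

Lemma edge_sub E e V : cover E \subset V -> e \in E -> e \subset V.
Proof. by move=> sV eE; apply: subset_trans sV; exact: bigcup_sup eE. Qed.

Lemma card_away_verts E e V : tame E -> cover E \subset V -> e \in E ->
  #|V :\: e| = #|V| - 4.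
Proof.
move=> tE sV eE; rewrite cardsD (setIidPr (edge_sub sV eE)).
by rewrite (card_edge tE eE).
Qed.

(** A matching among the edges disjoint from [e] can be enlarged by [e]. *)
Lemma nu_le_away E e s : tame E -> e \in E -> nu_le E s.+1 ->
  nu_le (away E e) s.
Proof.
move=> tE eE nuE M /andP[sM tM].
(* [trivIsetU1] yields [e \notin M] only for families without the empty set. *)
have n0 : set0 \notin M.
  apply/negP => /(subsetP sM)/(subsetP (away_sub E e)) /(card_edge tE).
  by rewrite cards0.
have [B /(subsetP sM)/away_disjoint //|tU neM] := @trivIsetU1 _ e _ _ tM n0.
have := nuE (e |: M); rewrite cardsU1 neM add1n ltnS; apply.
rewrite /matching tU andbT subUset sub1set eE.
exact: subset_trans sM (away_sub E e).
Qed.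

Lemma nu_le0 E : nu_le E 0 -> E = set0.
Proof.
move=> nu0; apply/eqP; apply/set0Pn => -[e eE].
have := nu0 [set e]; rewrite cards1 => /(_ _) H; suff: false by [].
apply: H; rewrite /matching sub1set eE; apply/trivIsetP => A B.
by rewrite !inE => /eqP-> /eqP->; rewrite eqxx.
Qed.

Lemma nu_le1_meet E e h : tame E -> nu_le E 1 -> e \in E -> h \in E ->
  h :&: e != set0.
Proof.
move=> tE nu1 eE hE; apply/negP => /eqP he0.
have /nu_le0 A0 := nu_le_away tE eE nu1.
by have := in_set0 h; rewrite -A0 inE hE he0 eqxx.
Qed.

Lemma reach_sub E e V : cover E \subset V -> reach E e \subset V.
Proof.
move=> sV; apply/bigcupsP => h /(subsetP (touching_sub E e)); exact: edge_sub.
Qed.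

Lemma deg_le E e V : tame E -> e \in E -> cover E \subset V ->
  2 * deg E e + 2 <= #|V| + has_partner E e.
Proof.
move=> tE eE sV; apply: leq_trans (deg_reach tE eE) _.
by rewrite leq_add2r subset_leq_card ?reach_sub.
Qed.

Lemma deg_settled E e V h : tame E -> e \in E -> cover E \subset V ->
  #|V| + has_partner E e <= 2 * deg E e + 2 -> h \in loose E e -> settled E e h.
Proof.
move=> tE eE sV full hD; apply: (deg_reach_settled tE eE hD).
apply: leq_trans full; by rewrite leq_add2r subset_leq_card ?reach_sub.
Qed.

Lemma deg_reach_all E e V : tame E -> e \in E -> cover E \subset V ->
  #|V| + has_partner E e <= 2 * deg E e + 2 -> reach E e = V.
Proof.
move=> tE eE sV full; apply/eqP; rewrite eqEcard reach_sub //.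
have := deg_reach tE eE; move: full; clear; lia.
Qed.

Lemma partner_loose1 E e f h : tame E -> e \in E -> f \in E -> partners e f ->
  h \in loose E e -> #|h :&: e| = 1.
Proof.
move=> tE eE fE pef hD; have [hE nhe he [//|c2]] := looseP tE eE hD.
have /card_gt1P[u [v [+ + nuv]]] : 1 < #|h :&: e| by rewrite c2.
rewrite !inE => /andP[uh ue] /andP[vh ve].
have nhf : h != f by apply: contraTneq hD => ->; rewrite partner_notin_loose.
case/eqP: nuv.
by apply: (partners_sep tE eE fE hE pef) => //; rewrite inE ?ue ?ve.
Qed.

(** Next to a partner of [e] the two-vertex traces are excluded, so being settled leaves only the
    alternative of a partner with the same trace; that partner is again loose. *)
Lemma settled_partner E e f h : tame E -> e \in E -> f \in E -> partners e f ->
  h \in loose E e -> settled E e h ->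
  exists2 k, k \in loose E e & partners h k /\ h :&: e = k :&: e.
Proof.
move=> tE eE fE pef hD; rewrite /settled (partner_loose1 tE eE fE pef hD) /=.
case/exists_inP => k kE /andP[phk /eqP hk]; exists k => //.
have c1 := partner_loose1 tE eE fE pef hD.
rewrite !inE kE -hk -card_gt0 c1 /=; apply/andP; split.
  by apply/negP => /eqP ke; move: c1; rewrite hk ke setIid (card_edge tE eE).
by rewrite /partners setIC -hk c1 andbF.
Qed.

(** Partnership matches the loose edges in pairs, as partners are unique. *)
Lemma even_loose E e f : tame E -> e \in E -> f \in E -> partners e f ->
  (forall h, h \in loose E e -> settled E e h) -> ~~ odd #|loose E e|.
Proof.
move=> tE eE fE pef st.
(* The default [h] is never reached on loose edges, since each of them has a loose partner. *)
pose mate h := odflt h [pick k in loose E e | partners h k].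
apply: (@even_card_involution _ mate) => h hD.
have mateP g : g \in loose E e -> mate g \in loose E e /\ partners g (mate g).
  move=> gD; rewrite /mate; case: pickP => [k /andP[]//|none].
  have [k kD [pk _]] := settled_partner tE eE fE pef gD (st g gD).
  by have := none k; rewrite kD pk.
have [mD pm] := mateP h hD; have [mmD pmm] := mateP _ mD.
have [hE _ _ _] := looseP tE eE hD; have [mE _ _ _] := looseP tE eE mD.
have [mmE _ _ _] := looseP tE eE mmD.
split=> //; first by rewrite eq_sym partners_neq.
by apply: (partner_uniq tE mE mmE hE pmm); rewrite partnersC.
Qed.

(** Failure would give [e] a partner and equality in [deg_le]. The number of loose edges, which is
    the degree minus two, is then even, while $(|V|-1)/2$ is odd. *)
Lemma deg_le_mod3 E e V : tame E -> e \in E -> cover E \subset V ->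
  #|V| %% 4 = 3 -> 2 * deg E e + 3 <= #|V|.
Proof.
move=> tE eE sV V3; rewrite leqNgt; apply/negP => big.
have := deg_le tE eE sV.
have [hp|np] := boolP (has_partner E e); last by move: V3 big; clear; lia.
move=> /= le; have full : #|V| + has_partner E e <= 2 * deg E e + 2.
  by rewrite hp /=; move: big V3; clear; lia.
have [f fE pef] := exists_inP hp.
have := even_loose tE eE fE pef (fun h => deg_settled tE eE sV full).
have := deg_partner tE eE hp; move: le big V3; clear; lia.
Qed.

Lemma deg_le_half E e V : tame E -> e \in E -> cover E \subset V ->
  #|V| %% 4 != 1 -> 4 <= #|V| -> deg E e <= (#|V| - 2) %/ 2.
Proof.
move=> tE eE sV V1 V4; have := deg_le tE eE sV.
have := deg_le_mod3 tE eE sV; move: V1 V4; case: has_partner; clear; lia.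
Qed.

Lemma full_mod1_partner E e V : tame E -> e \in E -> cover E \subset V ->
  2 * deg E e + 1 = #|V| ->
  exists f, [/\ f \in E, partners e f, reach E e = V &
    forall h, h \in loose E e -> settled E e h].
Proof.
move=> tE eE sV dV; have := deg_le tE eE sV.
have [hp _|np] := boolP (has_partner E e); last by move: dV; clear; lia.
have full : #|V| + has_partner E e <= 2 * deg E e + 2.
  by rewrite hp /= -dV; clear; lia.
have [f fE pef] := exists_inP hp; exists f; split=> //.
  exact: deg_reach_all full.
by move=> h; exact: (deg_settled tE eE sV full).
Qed.

(** If [g] missed [e], an edge [k] touching [g] would still reach the vertex [d] of [e] that lies
    outside the partner [f] of [e]. The last steps exclude such a [k]. *)
Lemma full_mod1_meet E V e g : tame E -> cover E \subset V ->
  (forall h, h \in E -> 2 * deg E h + 1 = #|V|) ->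
  e \in E -> g \in E -> g :&: e != set0.
Proof.
move=> tE sV full eE gE; apply/negP => /eqP ge0.
have [f [fE pef _ ste]] := full_mod1_partner tE eE sV (full e eE).
have [_ [_ _ rg _]] := full_mod1_partner tE gE sV (full g gE).
have [d dP] := partners_diff tE eE pef.
have : d \in e :\: f by rewrite dP set11.
rewrite inE => /andP[df de].
have : d \in reach E g by rewrite rg; apply: subsetP (edge_sub sV eE) d de.
case/bigcupP => k; rewrite inE => /andP[kE kg] dk.
have nke : k != e by apply: contraNneq kg => ->; rewrite setIC ge0.
have nkf : k != f by apply: contraNneq df => <-.
have kD : k \in loose E e.
  rewrite !inE kE nke /=; apply/andP; split.
    by apply/set0Pn; exists d; rewrite inE dk.
  by apply: contra nkf => pek; rewrite (partner_uniq tE eE kE fE pek pef).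
have c1 := partner_loose1 tE eE fE pef kD.
(* Now [k] takes the central role: [e] is settled at [k], so [e] has a partner with the same trace
   on [k], namely through [d]. By uniqueness this partner is [f], which misses [d]. *)
have eD : e \in loose E k.
  by rewrite !inE eE setIC -card_gt0 c1 eq_sym nke /partners c1 andbF.
have [k' [k'E pkk' _ stk]] := full_mod1_partner tE kE sV (full k kE).
have [e' e'D [pee' eek]] := settled_partner tE kE k'E pkk' eD (stk e eD).
have [e'E _ _ _] := looseP tE kE e'D.
have ef := partner_uniq tE eE e'E fE pee' pef.
have : d \in e' :&: k by rewrite -eek inE de.
by rewrite inE ef (negPf df).
Qed.

(** The edges covering [u] and [v] share a vertex, which closes a triangle
    with [h] unless it is [u] or [v]. *)
Lemma meeting_pair E S h u v : tame E -> S \subset E -> h \in E -> h \notin S ->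
  (forall k k', k \in S -> k' \in S -> k :&: k' != set0) ->
  u \in h -> v \in h -> u \in cover S -> v \in cover S ->
  exists k, [/\ k \in S, u \in k & v \in k].
Proof.
move=> tE /subsetP sSE hE nhS meet uh vh /bigcupP[k kS uk] /bigcupP[k' kS' vk'].
have [euv|nuv] := eqVneq u v; first by exists k; rewrite -euv.
case: (boolP (v \in k)) => vk; first by exists k.
case: (boolP (u \in k')) => uk'; first by exists k'.
have /set0Pn[y] := meet k k' kS kS'; rewrite inE => /andP[yk yk'].
exfalso; apply: (@no_triangle _ E tE k k' h u y v);
  rewrite ?(sSE k) ?(sSE k') //; try by apply: contraNneq nhS => <-.
- by apply: contraNneq vk => ->.
- by apply: contraNneq uk' => ->.
- by apply: contraNneq vk => <-.
Qed.

(** Take an edge of [S] through [u], [v] and one through [u], [w]. If the first misses [w], they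
    differ and form a triangle with [h]. *)
Lemma meeting_triple E S h u v w : tame E -> S \subset E -> h \in E -> h \notin S ->
  (forall k k', k \in S -> k' \in S -> k :&: k' != set0) ->
  u != v -> v != w -> u != w ->
  u \in h -> v \in h -> w \in h ->
  u \in cover S -> v \in cover S -> w \in cover S ->
  exists k, [/\ k \in S, u \in k, v \in k & w \in k].
Proof.
move=> tE sSE hE nhS meet nuv nvw nuw uh vh wh uS vS wS.
have [k [kS uk vk]] := meeting_pair tE sSE hE nhS meet uh vh uS vS.
case: (boolP (w \in k)) => wk; first by exists k.
have [k' [kS' uk' wk']] := meeting_pair tE sSE hE nhS meet uh wh uS wS.
have kk' : k != k' by apply: contraNneq wk => ->.
have nS g : g \in S -> g != h by move=> gS; apply: contraNneq nhS => <-.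
exfalso; apply: (@no_triangle _ E tE k k' h v u w);
  rewrite ?(subsetP sSE k) ?(subsetP sSE k') ?nS //; by rewrite eq_sym.
Qed.

Lemma deg_meeting S g : tame S -> nu_le S 1 -> g \in S -> deg S g = #|S|.
Proof.
move=> tS nuS gS; apply: eq_card => k; rewrite inE andb_idr // => kS.
exact: (nu_le1_meet tS nuS gS kS).
Qed.

Lemma deg_away_full E V e : tame E -> cover E \subset V -> nu_le E 2 ->
  e \in E -> 9 <= #|V| -> 2 * #|away E e| + 5 = #|V| -> deg E e <= 2.
Proof.
move=> tE sV nu2 eE V9 aV; set S := away E e.
have tS : tame S := tame_away e tE.
have sSE : S \subset E := away_sub E e.
have nuS : nu_le S 1 by apply: nu_le_away.
have meet k k' : k \in S -> k' \in S -> k :&: k' != set0.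
  by move=> kS kS'; apply: (nu_le1_meet tS nuS).
have sW : cover S \subset V :\: e by exact: cover_away.
have full g : g \in S -> 2 * deg S g + 1 = #|V :\: e|.
  move=> gS; rewrite (card_away_verts tE sV eE) deg_meeting // -aV -/S.
  by clear; lia.
have covS x : x \in V -> x \notin e -> x \in cover S.
  move=> xV xe; have /card_gt0P[g gS] : 0 < #|S|.
    by rewrite /S; move: aV V9; clear; lia.
  have [_ [_ _ rg _]] := full_mod1_partner tS gS sW (full g gS).
  have : x \in reach S g by rewrite rg inE xe.
  by move/bigcupP => [k /(subsetP (touching_sub S g)) kS xk]; apply/bigcupP; exists k.
suff L0 : loose E e = set0.
  have [hp|np] := boolP (has_partner E e).
    by rewrite (deg_partner tE eE hp) L0 cards0.
  by rewrite (deg_no_partner tE eE np) L0 cards0.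
apply/eqP/set0Pn => -[h hD]; have [hE nhe he c12] := looseP tE eE hD.
have nhS : h \notin S by rewrite inE negb_and he orbT.
have /card_gt1P[u [v [+ + nuv]]] : 1 < #|h :\: e|.
  by rewrite (card_outside e tE hE); move: c12; clear; lia.
rewrite !inE => /andP[ue uh] /andP[ve vh].
have hV := subsetP (edge_sub sV hE).
have [k [kS uk vk]] := meeting_pair tE sSE hE nhS meet uh vh
  (covS u (hV u uh) ue) (covS v (hV v vh) ve).
have [k' [kS' pkk' _ _]] := full_mod1_partner tS kS sW (full k kS).
have [kE kE'] := (subsetP sSE k kS, subsetP sSE k' kS').
case/eqP: nuv.
apply: (partners_sep tE kE kE' hE pkk' _ _ uh vh); rewrite ?inE ?uk ?vk //.
  by apply: contraNneq nhS => ->.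
by apply: contraNneq nhS => ->.
Qed.

Lemma edge_bound_step s n : 0 < s -> 4 * s.+1 <= n -> (n %% 4 != 1) || (1 < s) ->
  (n - 2) %/ 2 + edge_bound s (n - 4) = edge_bound s.+1 n.
Proof.
move=> s0 sn side; rewrite /edge_bound.
have -> : (s == 1) && (4 %| n - 4 - 1) = false by move: side sn; clear; lia.
have -> : (s.+1 == 1) && (4 %| n - 1) = false by move: s0; clear; lia.
have [m [-> -> ->]] : exists m, [/\ (n - 2) %/ 2 = m + s.+1,
    (n - 4 - 2 * s) %/ 2 = m & (n - 2 * s.+1) %/ 2 = m.+1].
  by exists ((n - 4 - 2 * s) %/ 2); move: sn; clear; split; lia.
by rewrite mulnS mulSn; clear; lia.
Qed.

(** Induction on [s]: the edges touching a chosen edge are counted by its degree, and the others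
    obey the bound for one disjoint edge less and four vertices less. *)
Theorem card_le_edge_bound s E V : 0 < s -> tame E -> cover E \subset V ->
  4 * s <= #|V| -> nu_le E s -> #|E| <= edge_bound s #|V|.
Proof.
case: s => // s _; elim: s => [|s IHs] in E V *.
  move=> tE sV V4 nu1; have [->|[e eE]] := set_0Vmem E; first by rewrite cards0.
  rewrite -(deg_meeting tE nu1 eE) /edge_bound /=.
  have := deg_le tE eE sV; have := deg_le_half tE eE sV.
  by case: (has_partner E e); move: V4; clear; case: ifP; lia.
move=> tE sV V4 nuE; have [->|[e0 eE0]] := set_0Vmem E; first by rewrite cards0.
have IH e : e \in E -> #|away E e| <= edge_bound s.+1 (#|V| - 4).
  move=> eE; rewrite -(card_away_verts tE sV eE).
  apply: IHs; [exact: tame_away|exact: cover_away| |exact: nu_le_away].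
  by rewrite (card_away_verts tE sV eE); move: V4; clear; lia.
have [V1|V1] := eqVneq (#|V| %% 4) 1; last first.
  rewrite (card_touching_away E e0) -edge_bound_step ?V1 //.
  apply: leq_add; last exact: IH.
  by apply: deg_le_half => //; move: V4; clear; lia.
(* When $|V|\equiv 1$ modulo $4$, the degree can exceed [(#|V| - 2) %/ 2] by one. An edge where it
   does not is the one to delete. *)
have [/existsP[e /andP[eE de]]|] :=
    boolP [exists e, (e \in E) && (2 * deg E e + 1 != #|V|)].
  have dle : deg E e <= (#|V| - 2) %/ 2.
    have := deg_le tE eE sV; move: V1 V4 de; case: (has_partner E e); clear; lia.
  have [s0|s1] := posnP s; last first.
    rewrite (card_touching_away E e) -edge_bound_step ?ltnS ?s1 ?orbT //.
    by apply: leq_add => //; exact: IH.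
  (* With two disjoint edges allowed, the remaining family falls under the exceptional value of
     [edge_bound], which is one too large. If that value is attained, [deg_away_full] makes the
     degree tiny. *)
  rewrite s0 (card_touching_away E e) in nuE V4 IH *.
  have := IH e eE; rewrite /edge_bound /=.
  have -> : 4 %| #|V| - 4 - 1 by move: V1 V4; clear; lia.
  have V9 : 9 <= #|V| by move: V1 V4; clear; lia.
  have [aV|aV] := eqVneq (2 * #|away E e| + 5) #|V|.
    by have := deg_away_full tE sV nuE eE V9 aV; move: aV V9 V1; clear; lia.
  by move: V1 V9 dle aV => /=; clear; lia.
rewrite negb_exists => /forallP full.
(* If every degree is exceptional, all edges meet each other, and [E] has only $(|V|-1)/2$ edges. *)
have fullE e : e \in E -> 2 * deg E e + 1 = #|V|.
  by move=> eE; have := full e; rewrite eE /= negbK => /eqP.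
have nu1 : #|E| = deg E e0.
  apply: esym; apply: eq_card => k; rewrite inE andb_idr // => kE.
  exact: (full_mod1_meet tE sV fullE).
rewrite nu1 /edge_bound /=; have := fullE e0 eE0.
have [m [-> leM Vm]] : exists m, [/\ (#|V| - 2 * s.+2) %/ 2 = m, s.+2 <= m &
    #|V| = 2 * m + 2 * s.+2 + 1].
  by exists ((#|V| - 2 * s.+2) %/ 2); move: V1 V4; clear; split; lia.
rewrite {}Vm => dV; have : 2 * m + s * m <= s.+2 * m by clear; lia.
have : s * s <= s * m by rewrite leq_mul2l; move: leM; clear; lia.
by move: dV leM; clear; nia.
Qed.

End Families.

(** * Extremal families of even order *)

(** For even [#|V|] the exceptional value of [edge_bound] cannot occur, so the last equation says
    that the bound is attained. The value [s = 0] is allowed, so that deletions can run down to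
    it. *)
Definition extremal (T : finType) (s : nat) (E : {set {set T}}) (V : {set T}) :=
  [/\ tame E, cover E \subset V, nu_le E s, 4 * s <= #|V| /\ ~~ odd #|V|
    & #|E| = s * ((#|V| - 2 * s) %/ 2)].

Section Extremal.

Variable T : finType.
Implicit Types (E S : {set {set T}}) (e f g h k V : {set T}) (u v w x y : T).

(** The bounds on the degree and on the remaining edges add up to exactly the size of [E], so both
    are attained. *)
Lemma extremal_step s E V e : extremal s.+1 E V -> e \in E ->
  2 * deg E e + 2 = #|V| /\ extremal s (away E e) (V :\: e).
Proof.
move=> [tE sV nuE [V4 V2] cE] eE; have cW := card_away_verts tE sV eE.
have tS := tame_away e tE; have sW := cover_away e sV.
have nuS := nu_le_away tE eE nuE.
have W4 : 4 * s <= #|V :\: e| by rewrite cW; move: V4; clear; lia.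
have W2 : ~~ odd #|V :\: e| by rewrite cW; move: V2 V4; clear; lia.
have leS : #|away E e| <= s * ((#|V :\: e| - 2 * s) %/ 2).
  case: s => [|s] in V4 cE nuE nuS W4 *; first by rewrite (nu_le0 nuS) cards0.
  have := card_le_edge_bound (ltn0Sn s) tS sW W4 nuS; rewrite /edge_bound.
  case: ifP => // /andP[_]; move: W4 W2; clear; lia.
have led : deg E e <= (#|V| - 2) %/ 2.
  by apply: deg_le_half => //; move: V2 V4; clear; lia.
have := card_touching_away E e; rewrite cE => eqE.
have [m [Vm Wm]] : exists m, #|V| = 2 * m.+1 + 2 * s.+1 /\
    (#|V :\: e| - 2 * s) %/ 2 = m.
  by exists ((#|V :\: e| - 2 * s) %/ 2); rewrite cW; move: V2 V4; clear; split; lia.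
move: eqE; have -> : (#|V| - 2 * s.+1) %/ 2 = m.+1 by rewrite Vm; clear; lia.
rewrite Wm in leS *; rewrite mulSn mulnS => eqE.
have de : deg E e = m + s.+1 by move: leS led eqE; rewrite Vm; clear; lia.
split; first by rewrite de Vm; clear; lia.
by split=> //; rewrite Wm; move: eqE; rewrite de; clear; lia.
Qed.

Lemma extremal_neq0 s E V : extremal s.+1 E V -> exists e, e \in E.
Proof.
move=> [_ _ _ [V4 _] cE]; apply/card_gt0P; rewrite cE muln_gt0 /=.
by move: V4; clear; lia.
Qed.

(** * Excluding partners from extremal families *)

Lemma meeting_away E e k k' : tame E -> nu_le E 2 -> e \in E ->
  k \in away E e -> k' \in away E e -> k :&: k' != set0.
Proof.
move=> tE nuE eE kS kS'.
exact: (nu_le1_meet (tame_away e tE) (nu_le_away tE eE nuE)).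
Qed.

Lemma partner_loose_away E V e f h : extremal 2 E V -> e \in E -> f \in E ->
  partners e f -> h \in loose E e -> exists2 k, k \in away E e & partners h k.
Proof.
move=> xE eE fE pef hD; have [tE sV nuE _ _] := xE.
have [_ xS] := extremal_step xE eE; have [tS sW nuS _ _] := xS.
have [hE nhe he _] := looseP tE eE hD.
have sSE := away_sub E e.
have nhS : h \notin away E e by rewrite inE negb_and he orbT.
have meet k k' := @meeting_away E e k k' tE nuE eE.
have c3 : #|h :\: e| = 3.
  by rewrite (card_outside e tE hE) (partner_loose1 tE eE fE pef hD).
have hW : h :\: e \subset V :\: e by rewrite setSD ?(edge_sub sV hE).
have degS g : g \in away E e -> #|V :\: e| = 2 * deg (away E e) g + 2.
  by move=> gS; have [] := extremal_step xS gS.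
have reach_cover g : reach (away E e) g \subset cover (away E e).
  apply/bigcupsP => k /(subsetP (touching_sub _ _)) kS; exact: bigcup_sup kS.
(* If some edge away from [e] has no partner there, equality in its degree bound makes these edges
   cover everything outside [e]. The three outer vertices of [h] then lie in one of them. *)
have [/existsP[g /andP[gS ng]]|] :=
    boolP [exists g, (g \in away E e) && ~~ has_partner (away E e) g].
  have covS : V :\: e \subset cover (away E e).
    rewrite -(deg_reach_all tS gS sW) ?reach_cover //.
    by rewrite (negPf ng) (degS g gS) addn0.
  have [|x [y [z]]] := card_gt2P _ (A := h :\: e); first by rewrite c3.
  move=> [[xD yD zD] [xy yz zx]].
  have cov t : t \in h :\: e -> t \in cover (away E e).
    by move=> tD; apply: (subsetP covS); apply: subsetP tD.
  have inh t : t \in h :\: e -> t \in h by rewrite inE => /andP[].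
  have xz : x != z by rewrite eq_sym.
  have [k [kS xk yk zk]] := meeting_triple tE sSE hE nhS meet xy yz xz
    (inh x xD) (inh y yD) (inh z zD) (cov x xD) (cov y yD) (cov z zD).
  exists k => //; have nhk : h != k by apply: contraNneq nhS => ->.
  rewrite /partners nhk eqn_leq (card_edgesI tE hE (subsetP sSE k kS) nhk) /=.
  apply/card_gt2P; exists x, y, z; split=> //.
  by rewrite !inE !inh ?xk ?yk ?zk.
(* Otherwise the edges away from [e] miss at most one vertex outside [e], so one of them contains
   two vertices of [h]; with its partner it contradicts [partners_sep]. *)
rewrite negb_exists => /forallP nop.
have [g gS] := extremal_neq0 xS.
have : #|V :\: e| <= #|reach (away E e) g|.+1.
  rewrite (degS g gS); have := deg_reach tS gS.
  by case: (has_partner _ g); clear; lia.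
have : #|reach (away E e) g| <= #|(V :\: e) :&: cover (away E e)|.
  by rewrite subset_leq_card // subsetI reach_sub // reach_cover.
have := cardsID (cover (away E e)) (V :\: e) => eqW leR leW.
have : 1 < #|(h :\: e) :&: cover (away E e)|.
  have := cardsID (cover (away E e)) (h :\: e); rewrite c3.
  have : #|(h :\: e) :\: cover (away E e)| <= #|(V :\: e) :\: cover (away E e)|.
    exact/subset_leq_card/setSD.
  by move: eqW leR leW; clear; lia.
case/card_gt1P => x [y [/setIP[xD xC] /setIP[yD yC] nxy]].
move: xD yD; rewrite !inE => /andP[_ xh] /andP[_ yh].
have [k [kS xk yk]] := meeting_pair tE sSE hE nhS meet xh yh xC yC.
have := nop k; rewrite kS negbK /= => /exists_inP[k' kS' pkk'].
case/eqP: nxy.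
have [kE kE'] := (subsetP sSE k kS, subsetP sSE k' kS').
apply: (partners_sep tE kE kE' hE pkk' _ _ xh yh); rewrite ?inE ?xk ?yk //.
  by apply: contraNneq nhS => ->.
by apply: contraNneq nhS => ->.
Qed.

(** The partners [k1], [k2] found away from [e] have no partner there. If they differ, [k2] is
    settled at [k1], hence meets it in two vertices, and so meets the union of the partners [k1],
    [h1] twice. *)
Lemma partner_loose_uniq E V e f h1 h2 : extremal 2 E V -> e \in E -> f \in E ->
  partners e f -> h1 \in loose E e -> h2 \in loose E e -> h1 = h2.
Proof.
move=> xE eE fE pef hD1 hD2; have [tE sV nuE _ _] := xE.
have [_ xS] := extremal_step xE eE; have [tS sW nuS _ _] := xS.
have sSE := subsetP (away_sub E e).
have notS h : h \in loose E e -> h \notin away E e.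
  by move=> hD; have [_ _ he _] := looseP tE eE hD; rewrite inE negb_and he orbT.
have lone h k : h \in loose E e -> k \in away E e -> partners h k ->
    ~~ has_partner (away E e) k.
  move=> hD kS phk; have [hE _ _ _] := looseP tE eE hD.
  apply/exists_inP => -[k' kS' pkk'].
  have ekh : k' = h.
    apply: (partner_uniq tE (sSE k kS) (sSE k' kS') hE pkk').
    by rewrite partnersC.
  by have := notS h hD; rewrite -ekh kS'.
have [k1 kS1 p1] := partner_loose_away xE eE fE pef hD1.
have [k2 kS2 p2] := partner_loose_away xE eE fE pef hD2.
have [hE1 _ _ _] := looseP tE eE hD1; have [hE2 _ _ _] := looseP tE eE hD2.
have q1 : partners k1 h1 by rewrite partnersC.
have [ek|nk] := eqVneq k2 k1.
  by apply: (partner_uniq tE (sSE k1 kS1) hE1 hE2 q1); rewrite partnersC -ek.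
have n1 := lone _ _ hD1 kS1 p1; have n2 := lone _ _ hD2 kS2 p2.
have kD : k2 \in loose (away E e) k1.
  rewrite inE nk inE kS2 (meeting_away tE nuE eE) //=.
  by apply: contra n1 => p12; apply/exists_inP; exists k2.
have full : #|V :\: e| + has_partner (away E e) k1 <=
    2 * deg (away E e) k1 + 2.
  by have [-> _] := extremal_step xS kS1; rewrite (negPf n1) addn0.
have := deg_settled tS kS1 sW full kD; case/orP; last first.
  case/exists_inP => k kS /andP[pk _].
  by case/negP: n2; apply/exists_inP; exists k.
move/eqP => c2; have /card_gt1P[u [v [+ + nuv]]] : 1 < #|k2 :&: k1| by rewrite c2.
rewrite !inE => /andP[u2 u1] /andP[v2 v1]; case/eqP: nuv.
apply: (partners_sep tE (sSE _ kS1) hE1 (sSE _ kS2) q1 nk _ u2 v2);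
  rewrite ?inE ?u1 ?v1 //.
by apply: contraNneq (notS _ hD1) => <-.
Qed.

(** At most one loose edge leaves degree at most three, while the degree is $(|V|-2)/2$. *)
Lemma extremal2_partner E V e f : extremal 2 E V -> e \in E -> f \in E ->
  partners e f -> #|V| = 8.
Proof.
move=> xE eE fE pef; have [tE _ _ [V4 _] _] := xE.
have [dV _] := extremal_step xE eE.
have hp : has_partner E e by apply/exists_inP; exists f.
have : #|loose E e| <= 1.
  by apply/card_le1_eqP => h1 h2 ? ?; exact: partner_loose_uniq xE eE fE pef _ _.
by have := deg_partner tE eE hp; move: dV V4; clear; lia.
Qed.

(** Deleting [g] and then [e2] leaves an edge [e3] disjoint from both. Only one vertex [d] of [g']
    lies outside [g], so one of [e2], [e3] avoids [g'] as well. *)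
Lemma extremal_away_partners s E V g g' : extremal s.+3 E V -> g \in E ->
  g' \in E -> partners g g' -> exists2 e, e \in E & g \in away E e /\ g' \in away E e.
Proof.
move=> xE gE gE' pg; have [tE _ _ _ _] := xE.
have [_ xS] := extremal_step xE gE; have [e2 eS2] := extremal_neq0 xS.
have [_ xS'] := extremal_step xS eS2; have [e3 eS3] := extremal_neq0 xS'.
have pg' : partners g' g by rewrite partnersC.
have [d dP] := partners_diff tE gE' pg'.
have good e : e \in away E g -> d \notin e ->
    exists2 e, e \in E & g \in away E e /\ g' \in away E e.
  move=> eS de; have eE := subsetP (away_sub E g) e eS.
  exists e => //; rewrite !inE gE gE'.
  have := away_disjoint eS; rewrite -setI_eq0 => -> /=; split=> //.
  rewrite setI_eq0 disjoint_subset; apply/subsetP => x xg'; rewrite inE.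
  have [xg|xg] := boolP (x \in g).
    by apply/negP => xe; have /disjointFr/(_ xg) := away_disjoint eS; rewrite xe.
  by have : x \in g' :\: g; [rewrite inE xg|rewrite dP => /set1P->].
case: (boolP (d \in e2)) => [d2|]; last exact: good.
apply: (good e3); first exact: subsetP (away_sub _ _) _ eS3.
by have /disjointFr-> := away_disjoint eS3.
Qed.

(** With [e] disjoint from both partners, exactly eight vertices lie outside [e]. They split into
    [g] and an edge [k] whose partner [h0] is loose at [g]. These two pairs of partners leave no
    room for a loose edge at [e], although [e] should have degree five. *)
Lemma extremal3_no_partner E V g g' : extremal 3 E V -> g \in E -> g' \in E ->
  ~~ partners g g'.
Proof.
move=> xE gE gE'; apply/negP => pg; have [tE sV _ _ _] := xE.
have [e eE [gS gS']] := extremal_away_partners xE gE gE' pg.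
have [de xS] := extremal_step xE eE; have [tS sW _ _ _] := xS.
have sSE := subsetP (away_sub E e).
have W8 := extremal2_partner xS gS gS' pg.
have [dg [_ _ _ _ cA]] := extremal_step xS gS.
have [k kA] : exists k, k \in away (away E e) g.
  by apply/card_gt0P; rewrite cA (card_away_verts tS sW gS) W8.
have kS := subsetP (away_sub _ _) _ kA; have kE := sSE k kS.
have hpg : has_partner (away E e) g by apply/exists_inP; exists g'.
have /card_gt0P[h0 hD0] : 0 < #|loose (away E e) g|.
  by have := deg_partner tS gS hpg; move: dg; rewrite W8; clear; lia.
have [hS0 _ _ _] := looseP tS gS hD0; have hE0 := sSE h0 hS0.
have [k1 kA1] := partner_loose_away xS gS gS' pg hD0.
have -> : k1 = k.
  have /eqP/cards1P[k2 A2] : #|away (away E e) g| = 1.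
    by rewrite cA (card_away_verts tS sW gS) W8.
  by move: kA kA1; rewrite A2 => /set1P-> /set1P->.
rewrite partnersC => pk.
have dgk := away_disjoint kA.
have Wgk : V :\: e = g :|: k.
  apply/esym/eqP; rewrite eqEcard subUset !(edge_sub sW) //= W8.
  by rewrite cardsU (disjoint_setI0 dgk) cards0 !(card_edge tE).
have gk x : x \in g -> x \notin k by move=> xg; have /disjointFr-> := dgk.
have [y yP] : exists y, g' :\: g = [set y].
  by apply: (partners_diff tE gE'); rewrite partnersC.
have [x xP] : exists x, h0 :\: k = [set x].
  by apply: (partners_diff tE hE0); rewrite partnersC.
have [yg yg'] : y \notin g /\ y \in g'.
  by apply/andP; have := set11 y; rewrite -yP inE.
have [xk xh0] : x \notin k /\ x \in h0.
  by apply/andP; have := set11 x; rewrite -xP inE.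
have yk : y \in k.
  by have := subsetP (edge_sub sW gS') y yg'; rewrite Wgk inE (negPf yg).
have xg : x \in g.
  by have := subsetP (edge_sub sW hS0) x xh0; rewrite Wgk inE (negPf xk) orbF.
(* An edge joining [g] to [k] meets each of the two partner unions once. Two triangles show that [u]
   is the vertex of [g] outside [g'] and [v] the vertex of [k] outside [h0]. Then [x] lies in [g']
   and [y] in [h0], so [h0] meets [g :|: g'] in both. *)
have key h u v : h \in E -> h \notin away E e -> u \in h -> v \in h ->
    u \in g -> v \in k -> False.
  move=> hE nhS uh vh ug vk.
  have nh z : z \in away E e -> z != h by move=> zS; apply: contraNneq nhS => <-.
  have nuv : u != v by apply: contraTneq vk => <-; exact: gk.
  have sep_g z : z \in h -> z \in g :|: g' -> z = u.
    move=> zh zg; apply: (partners_sep tE gE gE' hE pg) => //; rewrite ?inE ?ug //.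
      by rewrite eq_sym nh.
    by rewrite eq_sym nh.
  have sep_k z : z \in h -> z \in k :|: h0 -> z = v.
    move=> zh zk; apply: (partners_sep tE kE hE0 hE pk) => //; rewrite ?inE ?vk //.
      by rewrite eq_sym nh.
    by rewrite eq_sym nh.
  have vg' : v \notin g'.
    by apply: contra nuv => vg'; rewrite eq_sym (sep_g v) // inE vg' orbT.
  have uh0 : u \notin h0.
    by apply: contra nuv => uh0; rewrite (sep_k u) // inE uh0 orbT.
  have nxu : u != x by apply: contraNneq uh0 => ->.
  have nyv : y != v by apply: contraNneq vg' => <-.
  have nxv : x != v by apply: contraTneq vk => <-; exact: gk.
  have nyu : u != y by apply: contraNneq yg => <-.
  have vh0 : v \notin h0.
    apply/negP => vh0; apply: (@no_triangle _ E tE g h0 h u x v) => //;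
      try exact: nh; by apply: contraTneq ug => ->.
  have ug' : u \notin g'.
    apply/negP => ug'; apply: (@no_triangle _ E tE g' k h u y v) => //;
      try exact: nh; by apply: contraNneq vg' => ->.
  have [a aP] := partners_diff tE kE pk.
  have [b bP] := partners_diff tE gE pg.
  have yh0 : y \in h0.
    apply/negPn/negP => yh0; case/eqP: nyv.
    have /set1P-> : y \in [set a] by rewrite -aP inE yh0.
    by apply/esym/set1P; rewrite -aP inE vh0.
  have xg' : x \in g'.
    apply/negPn/negP => xg'; case/eqP: nxu.
    have /set1P-> : x \in [set b] by rewrite -bP inE xg'.
    by apply/set1P; rewrite -bP inE ug'.
  have exy : x = y.
    apply: (partners_sep tE gE gE' hE0 pg) => //; rewrite ?inE ?xg ?yg' ?orbT //.
      by apply: contraNneq yg => <-.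
    by apply: contraTneq hD0 => ->; rewrite partner_notin_loose.
  by move: yg; rewrite -exy xg.
have L0 : loose E e = set0.
  apply/eqP/set0Pn => -[h hD]; have [hE nhe he c12] := looseP tE eE hD.
  have nhS : h \notin away E e by rewrite inE negb_and he orbT.
  have /card_gt1P[u [v [+ + nuv]]] : 1 < #|h :\: e|.
    by rewrite (card_outside e tE hE); move: c12; clear; lia.
  have hW : h :\: e \subset g :|: k by rewrite -Wgk setSD ?(edge_sub sV hE).
  move=> uD vD; have := subsetP hW u uD; have := subsetP hW v vD.
  move: uD vD; rewrite !inE => /andP[_ uh] /andP[_ vh].
  have nh z : z \in away E e -> h != z by move=> zS; apply: contraNneq nhS => ->.
  move=> /orP[vg|vk] /orP[ug|uk].
  - case/eqP: nuv.
    by apply: (partners_sep tE gE gE' hE pg); rewrite ?(nh g) ?(nh g') // inE ?ug ?vg.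
  - exact: (key h v u).
  - exact: (key h u v).
  - case/eqP: nuv.
    by apply: (partners_sep tE kE hE0 hE pk); rewrite ?(nh k) ?(nh h0) // inE ?uk ?vk.
move: de W8; rewrite (card_away_verts tE sV eE).
have [hp|np] := boolP (has_partner E e).
  by rewrite (deg_partner tE eE hp) L0 cards0; clear; lia.
by rewrite (deg_no_partner tE eE np) L0 cards0; clear; lia.
Qed.

Lemma extremal_no_partner s E V g g' : 2 < s -> extremal s E V ->
  g \in E -> g' \in E -> ~~ partners g g'.
Proof.
case: s => [|[|[|s]]] // _; elim: s => [|s IHs] in E V *.
  exact: extremal3_no_partner.
move=> xE gE gE'; apply/negP => pg.
have [e eE [gS gS']] := extremal_away_partners xE gE gE' pg.
have [_ xS] := extremal_step xE eE.
by have := IHs _ _ xS gS gS'; rewrite pg.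
Qed.

End Extremal.

(** * Families without partners *)

(** The pairs that complete [P] to an edge. In a complete bipartite join of pairs this is the side
    opposite to [P]. *)
Definition edge_mates (T : finType) (E : {set {set T}}) (P : {set T}) :=
  [set h :\: P | h in [set h in E | P \subset h]].

Definition frame (T : finType) (E : {set {set T}}) (P Q : {set T}) :=
  [/\ #|P| = 2, #|Q| = 2, [disjoint P & Q], P :|: Q \in E
    & forall h, h \in E -> h :&: (P :|: Q) != set0 -> P \subset h \/ Q \subset h].

Lemma eq_subset_card (T : finType) (A B : {set T}) :
  #|A| = #|B| -> A \subset B -> A = B.
Proof. by move=> cAB sAB; apply/eqP; rewrite eqEcard sAB cAB /=. Qed.

Section Pairs.

Variables (T : finType) (E : {set {set T}}).
Hypotheses (tameE : tame E)
  (meet2 : forall h k, h \in E -> k \in E -> h != k -> h :&: k != set0 ->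
     #|h :&: k| = 2)
  (reachT : forall h, h \in E -> reach E h = setT).
Implicit Types (P Q X Y Z e h k g : {set T}) (t x y z : T).

Lemma setUD_disjoint P X : [disjoint X & P] -> (P :|: X) :\: P = X.
Proof. by move=> dXP; rewrite setDUl setDv set0U; apply/setDidPl. Qed.

Lemma edge_matesP P X : #|P| = 2 -> X \in edge_mates E P ->
  [/\ #|X| = 2, [disjoint X & P] & P :|: X \in E].
Proof.
move=> cP /imsetP[h]; rewrite inE => /andP[hE Ph] ->.
split.
- by rewrite cardsD (setIidPr Ph) cP (card_edge tameE hE).
- by rewrite disjoints_subset setDE subsetIr.
- by rewrite setUC setDE setUIl (setUC (~: P)) setUCr setIT (setUidPl Ph).
Qed.

Lemma edge_mates_in P X : [disjoint X & P] -> P :|: X \in E ->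
  X \in edge_mates E P.
Proof.
move=> dXP PXE; apply/imsetP; exists (P :|: X); first by rewrite inE PXE subsetUl.
by rewrite setUD_disjoint.
Qed.

(** Two edges through [P] share exactly two vertices, hence nothing besides [P]. *)
Lemma edge_mates_disjoint P X X' : #|P| = 2 -> X \in edge_mates E P ->
  X' \in edge_mates E P -> X != X' -> [disjoint X & X'].
Proof.
move=> cP XP XP' nXX'.
have [cX dX hE] := edge_matesP cP XP; have [cX' dX' hE'] := edge_matesP cP XP'.
have nh : P :|: X != P :|: X'.
  by apply: contra nXX' => /eqP eqh; rewrite -(setUD_disjoint dX) eqh setUD_disjoint.
have PI : (P :|: X) :&: (P :|: X') = P.
  apply/esym/eq_subset_card; last by rewrite subsetI !subsetUl.
  rewrite cP meet2 //; apply/set0Pn; have [p pP] : exists p, p \in P.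
    by apply/card_gt0P; rewrite cP.
  by exists p; rewrite !inE pP.
rewrite -setI_eq0; apply/set0Pn => -[z /setIP[zX zX']].
have : z \in P by rewrite -PI !inE zX zX' !orbT.
by have /disjointFr-> := dX.
Qed.

(** * The bipartite structure spanned by a frame *)

Section Frame.

Variables P Q : {set T}.
Hypothesis frPQ : frame E P Q.

Lemma frameC : frame E Q P.
Proof.
have [cP cQ dPQ e0E PorQ] := frPQ; split=> //; first by rewrite disjoint_sym.
  by rewrite setUC.
by move=> h hE; rewrite setUC => /(PorQ h hE) [|]; [right|left].
Qed.

Lemma frame_mate : Q \in edge_mates E P.
Proof.
have [cP cQ dPQ e0E _] := frPQ.
by apply: edge_mates_in; rewrite // disjoint_sym.
Qed.

Lemma frame_meet X : X \in edge_mates E P -> X != Q ->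
  (P :|: X) :&: (P :|: Q) = P.
Proof.
have [cP cQ dPQ e0E _] := frPQ => XP nXQ.
have [cX dX hE] := edge_matesP cP XP.
rewrite -setUIr; suff -> : X :&: Q = set0 by rewrite setU0.
exact/disjoint_setI0/(edge_mates_disjoint cP XP frame_mate).
Qed.

Lemma frame_neq X : X \in edge_mates E P -> X != Q -> P :|: X != P :|: Q.
Proof.
have [cP cQ dPQ e0E _] := frPQ => XP nXQ; have [cX dX hE] := edge_matesP cP XP.
apply: contra nXQ => /eqP eqh; rewrite -(setUD_disjoint dX) eqh setUD_disjoint //.
by rewrite disjoint_sym.
Qed.

End Frame.

Section Sides.

Variables P Q : {set T}.
Hypothesis frPQ : frame E P Q.

(** A common vertex would lie outside [P :|: Q], and [meet_outside] would identify a vertex of [P]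
    with one of [Q]. *)
Lemma frame_cross X Y : X \in edge_mates E P -> Y \in edge_mates E Q ->
  [disjoint X & Y].
Proof.
have [cP cQ dPQ e0E _] := frPQ; have frQP := frameC frPQ => XP YQ.
have [cX dX hE] := edge_matesP cP XP; have [cY dY gE] := edge_matesP cQ YQ.
have [->|nXQ] := eqVneq X Q; first by rewrite disjoint_sym.
have [->//|nYP] := eqVneq Y P.
have hI := frame_meet frPQ XP nXQ; have gI := frame_meet frQP YQ nYP.
have nh := frame_neq frPQ XP nXQ; have ng := frame_neq frQP YQ nYP.
rewrite [Q :|: P]setUC in gI ng.
have [p pP] : exists p, p \in P by apply/card_gt0P; rewrite cP.
have [q qQ] : exists q, q \in Q by apply/card_gt0P; rewrite cQ.
have pQ : p \notin Q by have /disjointFr-> := dPQ.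
rewrite -setI_eq0; apply/set0Pn => -[z /setIP[zX zY]].
have ze0 : z \notin P :|: Q.
  by rewrite inE negb_or (disjointFr dX zX) (disjointFr dY zY).
have nhg : P :|: X != Q :|: Y.
  apply: contraNneq pQ => eqh; rewrite -gI -eqh hI //.
have pq : p = q.
  by apply: (meet_outside tameE e0E hE gE nh ng nhg _ _ _ _ _ _ ze0);
    rewrite inE ?pP ?qQ ?zX ?zY ?orbT.
by rewrite pq qQ in pQ.
Qed.

(** The edge [k] meets [P :|: X] in two vertices, and as it avoids [P] these make up [X]. *)
Lemma mate_absorb X k z : X \in edge_mates E P -> k \in E -> z \in k ->
  z \in X -> [disjoint k & P] -> X \subset k.
Proof.
have [cP _ _ _ _] := frPQ => XP kE zk zX dkP.
have [cX dX hE] := edge_matesP cP XP.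
have [p pP] : exists p, p \in P by apply/card_gt0P; rewrite cP.
have nkh : k != P :|: X.
  by apply/negP => /eqP ek; have := disjointFl dkP pP; rewrite ek inE pP.
have c2 : #|k :&: (P :|: X)| = 2.
  by apply: meet2 => //; apply/set0Pn; exists z; rewrite !inE zk zX orbT.
have -> : X = k :&: (P :|: X); last exact: subsetIl.
apply/esym/eq_subset_card; first by rewrite c2 cX.
by rewrite setIUr (disjoint_setI0 dkP) set0U subsetIr.
Qed.

(** A vertex of [P] together with one of [X] and one of [X'] would be a triangle. *)
Lemma mates_no_union X X' k : X \in edge_mates E P -> X' \in edge_mates E P ->
  X != X' -> k \in E -> X \subset k -> X' \subset k -> [disjoint k & P] -> False.
Proof.
have [cP _ _ _ _] := frPQ => XP XP' nXX' kE Xk Xk' dkP.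
have [cX dX hE] := edge_matesP cP XP; have [cX' dX' hE'] := edge_matesP cP XP'.
have [p pP] : exists p, p \in P by apply/card_gt0P; rewrite cP.
have [x xX] : exists p, p \in X by apply/card_gt0P; rewrite cX.
have [y yX] : exists p, p \in X' by apply/card_gt0P; rewrite cX'.
have pk : p \notin k by have /disjointFl-> := dkP.
have xk := subsetP Xk x xX; have yk := subsetP Xk' y yX.
have dXX' := edge_mates_disjoint cP XP XP' nXX'.
have nh Z : P :|: Z != k by apply: contraNneq pk => <-; rewrite inE pP.
apply: (@no_triangle _ E tameE (P :|: X) (P :|: X') k x p y);
  rewrite ?nh ?inE ?pP ?xX ?yX ?orbT //.
- by apply: contra nXX' => /eqP eqh; rewrite -(setUD_disjoint dX) eqh setUD_disjoint.
- by apply: contraNneq pk => <-.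
- by apply: contraNneq pk => ->.
- by apply: contraTneq xX => ->; have /disjointFl-> := dXX'.
Qed.

End Sides.

Section Bipartite.

Variables P Q : {set T}.
Hypothesis frPQ : frame E P Q.

Let frQP : frame E Q P := frameC frPQ.

Lemma frame_cover t :
  exists2 Z : {set T}, t \in Z & Z \in edge_mates E P \/ Z \in edge_mates E Q.
Proof.
have [cP cQ dPQ e0E PorQ] := frPQ.
have PQ : P \in edge_mates E Q := frame_mate frQP.
have QP : Q \in edge_mates E P := frame_mate frPQ.
have : t \in reach E (P :|: Q) by rewrite reachT ?inE.
case/bigcupP => h; rewrite inE => /andP[hE he] th.
have [tP|tP] := boolP (t \in P); first by exists P; [|right].
have [tQ|tQ] := boolP (t \in Q); first by exists Q; [|left].
have [Ph|Qh] := PorQ h hE he.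
  exists (h :\: P); first by rewrite inE tP.
  by left; apply/imsetP; exists h; rewrite // inE hE.
exists (h :\: Q); first by rewrite inE tQ.
by right; apply/imsetP; exists h; rewrite // inE hE.
Qed.

(** Some edge [k] that meets [P :|: X] passes through a given vertex [y] of [Y]. It avoids [P] and
    [Q], so it absorbs both [X] and [Y] and equals their union. *)
Lemma frame_join X Y : X \in edge_mates E P -> Y \in edge_mates E Q ->
  X :|: Y \in E.
Proof.
have [cP cQ dPQ e0E PorQ] := frPQ => XP YQ.
have [cX dX hE] := edge_matesP cP XP; have [cY dY gE] := edge_matesP cQ YQ.
have [->//|nXQ] := eqVneq X Q.
have [->|nYP] := eqVneq Y P; first by rewrite setUC.
have dXY := frame_cross frPQ XP YQ.
have hI := frame_meet frPQ XP nXQ; have gI := frame_meet frQP YQ nYP.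
have nh := frame_neq frPQ XP nXQ; have ng := frame_neq frQP YQ nYP.
rewrite [Q :|: P]setUC in gI ng.
have [p pP] : exists p, p \in P by apply/card_gt0P; rewrite cP.
have [q qQ] : exists q, q \in Q by apply/card_gt0P; rewrite cQ.
have [y yY] : exists y, y \in Y by apply/card_gt0P; rewrite cY.
have PIQ x : x \in P -> x \in Q -> False by move=> xP; have /disjointFr-> := dPQ.
have e0P x : x \in P -> x \in P :|: Q by move=> xP; rewrite inE xP.
have e0Q x : x \in Q -> x \in P :|: Q by move=> xQ; rewrite inE xQ orbT.
have ye0 : y \notin P :|: Q.
  rewrite inE negb_or (disjointFr dY yY) andbT; apply/negP => yP.
  apply: (PIQ y yP); rewrite -gI !inE yY yP orbT //.
have : y \in reach E (P :|: X) by rewrite reachT ?inE.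
case/bigcupP => k; rewrite inE => /andP[kE kh] yk.
have nke0 : k != P :|: Q by apply: contraNneq ye0 => <-.
have yg : y \in Q :|: Y by rewrite inE yY orbT.
have dhg : (Q :|: Y) :&: (P :|: X) = set0.
  apply/setP => x; rewrite !inE; apply/negP => /andP[/orP[xQ|xY] /orP[xP|xX]].
  - exact: (PIQ x).
  - case: (PIQ x _ xQ); rewrite -hI; by rewrite !inE xX xQ !orbT.
  - case: (PIQ x xP); rewrite -gI; by rewrite !inE xY xP !orbT.
  - by have := disjointFr dXY xX; rewrite xY.
have nkg : k != Q :|: Y by apply: contraNneq kh => ->; rewrite dhg.
have yh : y \notin P :|: X.
  by apply/negP => yh; have /setP/(_ y) := dhg; rewrite !inE in yg yh *; rewrite yg yh.
have nkh : k != P :|: X by apply: contraNneq yh => <-.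
(* [k] and [Q :|: Y] share [y] outside [P :|: Q], so they meet [P :|: Q] in the same vertex, which
   cannot be in both [P] and [Q]. Below, the same argument with [P :|: X] and a vertex of [X] keeps
   [k] off [Q]. *)
have dkP : [disjoint k & P].
  rewrite -setI_eq0; apply/set0Pn => -[x /setIP[xk xP]].
  have xq : x = q.
    apply: (meet_outside tameE e0E kE gE nke0 ng nkg xk (e0P x xP) _
      (e0Q q qQ) yk yg ye0).
    by rewrite inE qQ.
  by apply: (PIQ x xP); rewrite xq.
have [x xk xX] : exists2 x, x \in k & x \in X.
  case/set0Pn: kh => x; rewrite !inE => /andP[xk /orP[xP|xX]]; last by exists x.
  by have := disjointFr dkP xk; rewrite xP.
have Xk := mate_absorb frPQ XP kE xk xX dkP.
have xh : x \in P :|: X by rewrite inE xX orbT.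
have xe0 : x \notin P :|: Q.
  rewrite inE negb_or (disjointFr dX xX) /=; apply/negP => xQ.
  by apply: (PIQ x _ xQ); rewrite -hI inE xh e0Q.
have dkQ : [disjoint k & Q].
  rewrite -setI_eq0; apply/set0Pn => -[z /setIP[zk zQ]].
  have zp : z = p.
    apply: (meet_outside tameE e0E kE hE nke0 nh nkh zk (e0Q z zQ) _
      (e0P p pP) xk xh xe0).
    by rewrite inE pP.
  by apply: (PIQ z _ zQ); rewrite zp.
have Yk := mate_absorb frQP YQ kE yk yY dkQ.
suff -> : X :|: Y = k by [].
apply: eq_subset_card; last by rewrite subUset Xk Yk.
by rewrite cardsU (disjoint_setI0 dXY) cards0 cX cY (card_edge tameE kE).
Qed.

(** An edge meeting [P :|: Q] contains one of the two pairs. Any other edge absorbs the pair of each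
    of its vertices, and its two pairs cannot lie on the same side. *)
Lemma frame_split k : k \in E ->
  exists X Y, [/\ X \in edge_mates E P, Y \in edge_mates E Q & k = X :|: Y].
Proof.
have [cP cQ dPQ e0E PorQ] := frPQ => kE.
have PQ : P \in edge_mates E Q := frame_mate frQP.
have QP : Q \in edge_mates E P := frame_mate frPQ.
have [ke0|] := eqVneq (k :&: (P :|: Q)) set0; last first.
  move=> /(PorQ k kE)[Pk|Qk].
    exists (k :\: P), P; split=> //; last first.
      by rewrite setUC setDE setUIr setUCr setIT (setUidPr Pk).
    by apply/imsetP; exists k; rewrite // inE kE.
  exists Q, (k :\: Q); split=> //; last first.
    by rewrite setDE setUIr setUCr setIT (setUidPr Qk).
  by apply/imsetP; exists k; rewrite // inE kE.
have dkP : [disjoint k & P].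
  by rewrite -setI_eq0 -subset0 -ke0 setIS ?subsetUl.
have dkQ : [disjoint k & Q].
  by rewrite -setI_eq0 -subset0 -ke0 setIS ?subsetUr.
have pick t : t \in k -> exists Z : {set T}, [/\ t \in Z, Z \subset k &
    Z \in edge_mates E P \/ Z \in edge_mates E Q].
  move=> tk; have [Z tZ ZPQ] := frame_cover t; exists Z; split=> //.
  case: ZPQ => ZP; first exact: (mate_absorb frPQ ZP kE tk tZ dkP).
  exact: (mate_absorb frQP ZP kE tk tZ dkQ).
have card2 Z : Z \in edge_mates E P \/ Z \in edge_mates E Q -> #|Z| = 2.
  by case=> [/(edge_matesP cP)|/(edge_matesP cQ)] [].
have [t tk] : exists t, t \in k by apply/card_gt0P; rewrite (card_edge tameE kE).
have [Z [tZ Zk ZPQ]] := pick t tk.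
have [u] : exists u, u \in k :\: Z.
  by apply/card_gt0P; rewrite cardsD (setIidPr Zk) (card_edge tameE kE) card2.
rewrite inE => /andP[uZ uk]; have [Z' [uZ' Zk' ZPQ']] := pick u uk.
have nZ : Z != Z' by apply: contraNneq uZ => ->.
have join X Y : X \in edge_mates E P -> Y \in edge_mates E Q ->
    X \subset k -> Y \subset k -> k = X :|: Y.
  move=> XP YQ Xk Yk; apply/esym/eq_subset_card; last by rewrite subUset Xk.
  rewrite cardsU (disjoint_setI0 (frame_cross frPQ XP YQ)) cards0.
  by rewrite (card_edge tameE kE) !card2; [|right|left].
case: ZPQ ZPQ' => [ZP|ZQ] [ZP'|ZQ'].
- by case: (mates_no_union frPQ ZP ZP' nZ kE Zk Zk' dkP).
- by exists Z, Z'; split=> //; exact: join.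
- by exists Z', Z; split=> //; exact: join.
- by case: (mates_no_union frQP ZQ ZQ' nZ kE Zk Zk' dkQ).
Qed.

Lemma frame_disjoint : [disjoint edge_mates E P & edge_mates E Q].
Proof.
have [cP cQ _ _ _] := frPQ.
rewrite -setI_eq0; apply/set0Pn => -[Z /setIP[ZP ZQ]].
have := frame_cross frPQ ZP ZQ; rewrite -setI_eq0 setIid -cards_eq0.
by have [-> _ _] := edge_matesP cP ZP.
Qed.

Lemma frame_trivIset : trivIset (edge_mates E P :|: edge_mates E Q).
Proof.
have [cP cQ _ _ _] := frPQ; apply/trivIsetP => A B.
rewrite !inE => /orP[AP|AQ] /orP[BP|BQ] nAB.
- exact: edge_mates_disjoint cP AP BP nAB.
- exact: (frame_cross frPQ AP BQ).
- by rewrite disjoint_sym; exact: (frame_cross frPQ BP AQ).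
- exact: edge_mates_disjoint cQ AQ BQ nAB.
Qed.

Lemma frame_card2 Z : Z \in edge_mates E P :|: edge_mates E Q -> #|Z| = 2.
Proof.
have [cP cQ _ _ _] := frPQ.
by rewrite inE => /orP[/(edge_matesP cP)|/(edge_matesP cQ)] [].
Qed.

Lemma frame_coverT : cover (edge_mates E P :|: edge_mates E Q) = setT.
Proof.
apply/setP => t; rewrite [RHS]inE; have [Z tZ ZPQ] := frame_cover t.
by apply/bigcupP; exists Z; rewrite // inE; apply/orP.
Qed.

Lemma frame_cardT : 2 * (#|edge_mates E P| + #|edge_mates E Q|) = #|T|.
Proof.
rewrite -cardsT -frame_coverT -(eqP frame_trivIset).
rewrite (eq_bigr (fun=> 2)) ?sum_nat_const; last by move=> Z; exact: frame_card2.
by rewrite cardsU (disjoint_setI0 frame_disjoint) cards0 subn0 mulnC.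
Qed.

Lemma frame_edges :
  E = [set X :|: Y | X in edge_mates E P, Y in edge_mates E Q].
Proof.
apply/setP => k; apply/idP/imset2P => [/frame_split[X [Y [XP YQ ->]]]|].
  by exists X Y.
by case=> X Y XP YQ ->; exact: frame_join.
Qed.

Lemma frame_card : #|E| = #|edge_mates E P| * #|edge_mates E Q|.
Proof.
rewrite [in LHS]frame_edges -cardsX curry_imset2X card_in_imset //.
have [cP cQ _ _ _] := frPQ.
have eqmem X X' Y' t : X \in edge_mates E P -> X' \in edge_mates E P ->
    Y' \in edge_mates E Q -> t \in X -> t \in X' :|: Y' -> X = X'.
  move=> XP XP' YQ' tX; rewrite inE => /orP[tX'|tY'].
    apply/eqP/negPn/negP => /(edge_mates_disjoint cP XP XP').
    by move/disjointFr/(_ tX); rewrite tX'.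
  by have /disjointFr/(_ tX) := frame_cross frPQ XP YQ'; rewrite tY'.
have eqmem' Y X' Y' t : Y \in edge_mates E Q -> X' \in edge_mates E P ->
    Y' \in edge_mates E Q -> t \in Y -> t \in X' :|: Y' -> Y = Y'.
  move=> YQ XP' YQ' tY; rewrite inE => /orP[tX'|tY'].
    by have /disjointFr/(_ tX') := frame_cross frPQ XP' YQ; rewrite tY.
  apply/eqP/negPn/negP => /(edge_mates_disjoint cQ YQ YQ').
  by move/disjointFr/(_ tY); rewrite tY'.
move=> [X Y] [X' Y']; rewrite !inE /= => /andP[XP YQ] /andP[XP' YQ'] eqXY.
have [x xX] : exists x, x \in X.
  by apply/card_gt0P; have [-> _ _] := edge_matesP cP XP.
have [y yY] : exists y, y \in Y.
  by apply/card_gt0P; have [-> _ _] := edge_matesP cQ YQ.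
have xU : x \in X' :|: Y' by rewrite -eqXY inE xX.
have yU : y \in X' :|: Y' by rewrite -eqXY inE yY orbT.
by rewrite (eqmem _ _ _ _ XP XP' YQ' xX xU) (eqmem' _ _ _ _ YQ XP' YQ' yY yU).
Qed.

End Bipartite.

(** Any two intersecting edges give a frame: an edge [h] with one vertex in [h0 :&: e0] and one in
    [e0 :\: h0] closes a triangle with [h0] and [e0]. *)
Lemma frame_exists e0 h0 : e0 \in E -> h0 \in E -> h0 != e0 ->
  h0 :&: e0 != set0 -> frame E (h0 :&: e0) (e0 :\: h0).
Proof.
move=> eE hE nhe he; have cP := meet2 hE eE nhe he.
have eU : h0 :&: e0 :|: e0 :\: h0 = e0 by rewrite setIC setID.
have cQ : #|e0 :\: h0| = 2 by rewrite cardsD setIC cP (card_edge tameE eE).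
split=> //.
  rewrite -setI_eq0; apply/eqP/setP => x; rewrite !inE.
  by case: (x \in h0); rewrite ?andbF.
  by rewrite eU.
rewrite eU => h hE' he'.
have [->|nhe'] := eqVneq h e0; first by left; exact: subsetIr.
have [->|nhh] := eqVneq h h0; first by left; exact: subsetIl.
have c2 := meet2 hE' eE nhe' he'.
have [/existsP[x /andP[xh /setIP[xh0 xe0]]]|] :=
    boolP [exists x, (x \in h) && (x \in h0 :&: e0)].
  left; apply/subsetP => w /setIP[wh0 we0]; apply/negPn/negP => wh.
  have [/existsP[y /and3P[yh ye0 yh0]]|] :=
      boolP [exists y, [&& y \in h, y \in e0 & y \notin h0]].
    apply: (@no_triangle _ E tameE h h0 e0 y x w) => //.
    - by apply: contraNneq yh0 => ->.
    - by apply: contraNneq wh => <-.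
    - by apply: contraNneq wh => <-.
  rewrite negb_exists => /forallP none.
  have sub : h :&: e0 \subset h0 :&: e0.
    apply/subsetP => y /setIP[yh ye0]; rewrite inE ye0 andbT.
    by have := none y; rewrite yh ye0 negbK.
  have := eq_subset_card (etrans c2 (esym cP)) sub => /setP/(_ w).
  by rewrite !inE wh0 we0 (negPf wh).
rewrite negb_exists => /forallP none; right.
have sub : h :&: e0 \subset e0 :\: h0.
  apply/subsetP => y /setIP[yh ye0]; rewrite inE ye0 andbT.
  by have := none y; rewrite inE yh ye0 andbT.
by rewrite -(eq_subset_card (etrans c2 (esym cQ)) sub) subsetIl.
Qed.

End Pairs.

(** * The graphs H_4(s, n) *)

Section Labels.

Variable n : nat.
Implicit Types (l : seq nat) (x : 'I_n).

Lemma card_label_set_le l : #|label_set n l| <= size l.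
Proof.
rewrite cardE -(size_map val); apply: uniq_leq_size.
  by rewrite map_inj_uniq ?enum_uniq //; exact: val_inj.
by move=> m /mapP[x]; rewrite mem_enum inE => xl ->.
Qed.

Lemma card_label_set l : uniq l -> all (fun m => m < n) l ->
  #|label_set n l| = size l.
Proof.
move=> ul /allP ln; apply/eqP; rewrite eqn_leq card_label_set_le cardE.
rewrite -(size_map val (enum _)); apply: uniq_leq_size => // m ml.
by apply/mapP; exists (Ordinal (ln m ml)); rewrite // mem_enum inE.
Qed.

Lemma label_set_in l m (mn : m < n) : (Ordinal mn \in label_set n l) = (m \in l).
Proof. by rewrite inE. Qed.

End Labels.

(** With [k = (n - 1) %/ 4], the edges [2 * i] and [2 * i + 1] are the two edges of
    [H4_one n] for the index [i], and [2 * k] is the extra edge when [4 %| n]. *)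
Definition one_edge (n j : nat) : {set 'I_n} :=
  label_set n [:: 0; 2 * j + ~~ odd j; 2 * j + ~~ odd j + 1; 2 * j + ~~ odd j + 2].

Lemma H4_oneE n : 0 < n ->
  H4_one n = [set one_edge n j | j : 'I_(2 * ((n - 1) %/ 4) + (4 %| n))].
Proof.
move=> n0; rewrite /H4_one; set k := (n - 1) %/ 4.
have ev i : one_edge n (2 * i) =
    label_set n [:: 0; 4 * i + 1; 4 * i + 2; 4 * i + 3].
  rewrite /one_edge oddM /=; congr label_set.
  by congr [:: _; _; _; _]; clear; lia.
have od i : one_edge n (2 * i + 1) =
    label_set n [:: 0; 4 * i + 2; 4 * i + 3; 4 * i + 4].
  rewrite /one_edge oddD oddM /=; congr label_set.
  by congr [:: _; _; _; _]; clear; lia.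
apply/setP => e; apply/idP/imsetP.
  rewrite !inE => /orP[/orP[]|].
  - case/imsetP => i _ ->.
    have lt : 2 * i < 2 * k + (4 %| n) by have := ltn_ord i; clear; lia.
    by exists (Ordinal lt); rewrite //= ev.
  - case/imsetP => i _ ->.
    have lt : 2 * i + 1 < 2 * k + (4 %| n) by have := ltn_ord i; clear; lia.
    by exists (Ordinal lt); rewrite //= od.
  - case: ifP => // d4; rewrite ?inE // => /eqP->.
    have lt : 2 * k < 2 * k + true by rewrite addn1.
    by exists (Ordinal lt); rewrite //= ev.
case=> -[j ltj] _ ->; rewrite /= -/k in ltj *.
have ej : j = 2 * (j %/ 2) + odd j by clear; lia.
rewrite !inE; case: (ltnP (j %/ 2) k) => jk.
  rewrite ej; case: (odd j) => /=.
    by rewrite od; apply/orP; left; apply/orP; right; apply/imsetP; exists (Ordinal jk).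
  rewrite addn0 ev; apply/orP; left; apply/orP; left; apply/imsetP.
  by exists (Ordinal jk).
have jeq : j = 2 * k by move: ltj ej jk; case: (4 %| n); case: odd; clear; lia.
have -> : 4 %| n by move: ltj; rewrite jeq; case: (4 %| n) => //; clear; lia.
by rewrite jeq ev !inE eqxx orbT.
Qed.

Lemma one_edge_lt n j : 0 < n -> j < 2 * ((n - 1) %/ 4) + (4 %| n) ->
  2 * j + ~~ odd j + 2 < n.
Proof.
case: (boolP (4 %| n)) => d4 /=; case: (boolP (odd j)) => oj /=;
  move: d4 oj; clear; lia.
Qed.

Lemma card_one_edge n j : 0 < n -> j < 2 * ((n - 1) %/ 4) + (4 %| n) ->
  #|one_edge n j| = 4.
Proof.
move=> n0 /(one_edge_lt n0) lt; rewrite card_label_set //=.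
  rewrite !inE; move: lt; clear; lia.
by move: lt; clear; lia.
Qed.

(** The nonzero vertices fall into blocks of four consecutive labels, and each block carries at most
    two edges. *)
Lemma one_edge_pos n j x : x \in one_edge n j -> 0 < val x ->
  (val x).-1 %/ 4 = j %/ 2.
Proof. by rewrite inE !inE; move: (val x) => m; clear; lia. Qed.

Lemma H4_one_four n : 0 < n -> four_graph (H4_one n).
Proof. by move=> n0 e; rewrite H4_oneE // => /imsetP[j _ ->]; exact: card_one_edge. Qed.

Lemma H4_one_zero n (n0 : 0 < n) e : e \in H4_one n -> Ordinal n0 \in e.
Proof. by rewrite H4_oneE // => /imsetP[j _ ->]; rewrite inE. Qed.

Lemma H4_one_triangle_free n : 0 < n -> berge_triangle_free (H4_one n).
Proof.
move=> n0 [e1 [e2 [e3 [[E1 E2 E3] [[n12 n23 n13] [x [y [z [[nxy nyz nxz]]]]]]]]]].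
rewrite !subUset !sub1set => -[/andP[x1 y1] /andP[y2 z2] /andP[x3 z3]].
move: E1 E2 E3; rewrite H4_oneE // => /imsetP[j1 _ e1E] /imsetP[j2 _ e2E].
case/imsetP => j3 _ e3E; subst e1 e2 e3.
have pos (a b : 'I_n) : a != b -> 0 < val a \/ 0 < val b.
  move=> nab; case: (posnP (val a)) => [a0|]; last by left.
  case: (posnP (val b)) => [b0|]; last by right.
  by case/eqP: nab; apply: val_inj; rewrite a0 b0.
(* At most one corner of the triangle is the vertex [0]; the other corners force all three edges
   into one block, which has only two. *)
have half : j1 %/ 2 = j2 %/ 2 /\ j2 %/ 2 = j3 %/ 2.
  case: (posnP (val x)) => x0.
    have [|y0] := pos x y nxy; first by rewrite x0.
    have [|z0] := pos x z nxz; first by rewrite x0.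
    by rewrite -(one_edge_pos y1 y0) -(one_edge_pos z3 z0) (one_edge_pos y2 y0)
      (one_edge_pos z2 z0).
  have e13 : j1 %/ 2 = j3 %/ 2.
    by rewrite -(one_edge_pos x1 x0) (one_edge_pos x3 x0).
  have [y0|z0] := pos y z nyz.
    have e12 : j1 %/ 2 = j2 %/ 2.
      by rewrite -(one_edge_pos y1 y0) (one_edge_pos y2 y0).
    by rewrite -e12.
  have e23 : j2 %/ 2 = j3 %/ 2.
    by rewrite -(one_edge_pos z2 z0) (one_edge_pos z3 z0).
  by rewrite e23.
have neq (a b : 'I_(2 * ((n - 1) %/ 4) + (4 %| n))) :
    one_edge n a != one_edge n b -> a != b :> nat.
  by apply: contra => /eqP->.
move: (neq _ _ n12) (neq _ _ n23) (neq _ _ n13) half.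
by move: (val j1) (val j2) (val j3) => a b c; clear; lia.
Qed.

Lemma card_H4_one n : 0 < n -> #|H4_one n| = 2 * ((n - 1) %/ 4) + (4 %| n).
Proof.
move=> n0; rewrite H4_oneE // card_imset ?card_ord // => j1 j2.
(* The least nonzero label of an edge increases with its index, so for [j1 < j2] it is missing from
   the second edge. *)
wlog le12 : j1 j2 / j1 <= j2 => [wl|] eqj.
  by case: (leqP j1 j2) => [/wl->//|/ltnW/wl->].
have lt2 := one_edge_lt n0 (ltn_ord j2).
have lt : 2 * j1 + ~~ odd j1 < n.
  have := one_edge_lt n0 (ltn_ord j1); clear; lia.
have : Ordinal lt \in one_edge n j2.
  by rewrite -eqj label_set_in !inE eqxx orbT.
rewrite label_set_in !inE => mem; apply: val_inj => /=; move: mem le12.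
by move: (val j1) (val j2) => a b; clear; lia.
Qed.

Lemma H4_one_nu n : 0 < n -> nu_le (H4_one n) 1.
Proof.
move=> n0 M /andP[sM /trivIsetP tM]; apply/card_le1_eqP => A B AM BM.
apply/eqP/negPn/negP => nAB.
have A0 := H4_one_zero n0 (subsetP sM A AM).
have B0 := H4_one_zero n0 (subsetP sM B BM).
have := tM A B AM BM; rewrite eq_sym nAB => /(_ isT)/disjointFr/(_ A0).
by rewrite B0.
Qed.

(** * The grid families of the case $s\ge 2$ *)

Definition grid_edge (s n i j : nat) : {set 'I_n} :=
  label_set n [:: 2 * i; 2 * i + 1; 2 * s + 2 * j; 2 * s + 2 * j + 1].

Section Grid.

Variables s n : nat.
Hypothesis sn : 2 * s <= n.

Let m := (n - 2 * s) %/ 2.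

Lemma H4_manyP e : reflect (exists i j, [/\ i < s, j < m & e = grid_edge s n i j])
  (e \in H4_many s n).
Proof.
apply: (iffP imset2P) => [[i j _ _ ->]|[i [j [li lj ->]]]].
  by exists i, j.
by exists (Ordinal li) (Ordinal lj).
Qed.

Lemma card_grid_edge i j : i < s -> j < m -> #|grid_edge s n i j| = 4.
Proof.
move=> li lj; rewrite card_label_set //=.
  by rewrite !inE; move: li; clear; lia.
by move: li lj sn; rewrite /m; clear; lia.
Qed.

Lemma grid_edge_mem i j (x : 'I_n) : i < s -> x \in grid_edge s n i j ->
  (x < 2 * s /\ x %/ 2 = i) \/ (2 * s <= x /\ (x - 2 * s) %/ 2 = j).
Proof. by move=> li; rewrite inE !inE /=; move: (nat_of_ord x) li => a; clear; lia. Qed.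

Lemma H4_many_four : four_graph (H4_many s n).
Proof. by move=> e /H4_manyP[i [j [li lj ->]]]; exact: card_grid_edge. Qed.

(** Each corner makes its two edges agree in [i] or in [j]. Two corners of one kind make all three
    edges agree in that index; the third corner then makes two edges equal, or is of the same kind,
    and three distinct vertices lie in one pair. *)
Lemma H4_many_triangle_free : berge_triangle_free (H4_many s n).
Proof.
move=> [e1 [e2 [e3 [[E1 E2 E3] [[n12 n23 n13] [x [y [z [[nxy nyz nxz]]]]]]]]]].
rewrite !subUset !sub1set => -[/andP[x1 y1] /andP[y2 z2] /andP[x3 z3]].
have [i1 [j1 [li1 lj1 e1E]]] := H4_manyP _ E1.
have [i2 [j2 [li2 lj2 e2E]]] := H4_manyP _ E2.
have [i3 [j3 [li3 lj3 e3E]]] := H4_manyP _ E3.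
subst e1 e2 e3.
have neq i j i' j' : grid_edge s n i j != grid_edge s n i' j' ->
    ~ (i = i' /\ j = j').
  by move=> + [ei ej]; rewrite ei ej eqxx.
have ndist (a b : 'I_n) : a != b -> nat_of_ord a <> b.
  by move=> /eqP nab /val_inj.
move: (neq _ _ _ _ n12) (neq _ _ _ _ n23) (neq _ _ _ _ n13).
move: (ndist _ _ nxy) (ndist _ _ nyz) (ndist _ _ nxz).
move: (grid_edge_mem li1 x1) (grid_edge_mem li1 y1) (grid_edge_mem li2 y2).
move: (grid_edge_mem li2 z2) (grid_edge_mem li3 x3) (grid_edge_mem li3 z3).
move: (nat_of_ord x) (nat_of_ord y) (nat_of_ord z) => a b c; clear.
by move=> [[? ?]|[? ?]] [[? ?]|[? ?]] [[? ?]|[? ?]] [[? ?]|[? ?]]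
  [[? ?]|[? ?]] [[? ?]|[? ?]]; lia.
Qed.

Lemma H4_many_nu : nu_le (H4_many s n) s.
Proof.
move=> M /andP[/subsetP sM /trivIsetP tM].
(* [c i] is the member of [M] through the vertex [2 * i], unique by disjointness; the default [set0]
   stands for indices without one. *)
pose c (i : 'I_s) := odflt set0 [pick e in M | [exists x in e, val x == 2 * i]].
suff /subset_leq_card le : M \subset [set c i | i : 'I_s].
  apply: leq_trans le _; apply: leq_trans (leq_imset_card _ _) _.
  by rewrite card_ord.
apply/subsetP => e eM; have [i [j [li lj eE]]] := H4_manyP _ (sM e eM).
apply/imsetP; exists (Ordinal li) => //; rewrite /c.
have lin : 2 * i < n by move: sn li; clear; lia.
have xe : Ordinal lin \in e by rewrite eE label_set_in inE eqxx.
case: pickP => [e' /andP[eM' /exists_inP[x xe' /eqP vx]]|/(_ e)] /=; last first.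
  rewrite eM => /negbT/exists_inP[]; by exists (Ordinal lin).
apply/eqP/negPn/negP => /(tM e e' eM eM')/disjointFr/(_ xe).
by rewrite (_ : Ordinal lin = x) ?xe' //; apply: val_inj.
Qed.

Lemma card_H4_many : #|H4_many s n| = s * m.
Proof.
have -> : H4_many s n = [set grid_edge s n p.1 p.2 | p : 'I_s * 'I_m].
  apply/setP => e; apply/H4_manyP/imsetP => [[i [j [li lj ->]]]|[[i j] _ ->]].
    by exists (Ordinal li, Ordinal lj).
  by exists i, j.
rewrite card_imset; first by rewrite card_prod !card_ord.
move=> [i j] [i' j'] /= eqe.
have lin : 2 * i < n by have := ltn_ord i; move: sn; clear; lia.
have ljn : 2 * s + 2 * j < n by have := ltn_ord j; move: sn; clear; lia.
have : Ordinal lin \in grid_edge s n i' j' by rewrite -eqe label_set_in inE eqxx.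
have : Ordinal ljn \in grid_edge s n i' j'.
  by rewrite -eqe label_set_in !inE eqxx !orbT.
move/(grid_edge_mem (ltn_ord i')) => /= Hj /(grid_edge_mem (ltn_ord i')) /= Hi.
have := ltn_ord i => li.
by congr pair; apply: val_inj => /=; move: Hi Hj li; clear; lia.
Qed.

End Grid.

(** * Labelling a complete bipartite join of pairs by the grid *)

Definition rank (U : finType) (A : {set U}) (u : U) : nat := index u (enum A).

Lemma rank_lt (U : finType) (A : {set U}) u : u \in A -> rank A u < #|A|.
Proof. by move=> uA; rewrite cardE index_mem mem_enum. Qed.

Lemma rank_inj (U : finType) (A : {set U}) u v : u \in A -> v \in A ->
  rank A u = rank A v -> u = v.
Proof.
rewrite -2!(mem_enum A) => uA vA eqi.
by rewrite -(nth_index u uA) -/(rank A u) eqi nth_index.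
Qed.

Section Isomorphism.

Variables (s n : nat) (T : finType) (E X Y : {set {set T}}).
Hypotheses (sn : 2 * s <= n) (n2 : ~~ odd n) (cT : #|T| = n)
  (cY : #|Y| = s) (cX : #|X| = (n - 2 * s) %/ 2)
  (dYX : [disjoint Y & X]) (tYX : trivIset (Y :|: X))
  (covT : cover (Y :|: X) = setT)
  (pairs : forall Z, Z \in Y :|: X -> #|Z| = 2)
  (edges : E = [set x :|: y | x in X, y in Y])
  (cE : #|E| = s * ((n - 2 * s) %/ 2)).

Let block t := pblock (Y :|: X) t.
Let pos t := rank (block t) t.
(** Pairs of [Y] take consecutive labels below [2 * s], pairs of [X] those from [2 * s] on. *)
Let label t :=
  if block t \in Y then 2 * rank Y (block t) + pos t
  else 2 * s + 2 * rank X (block t) + pos t.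

Lemma rankY_lt Z : Z \in Y -> rank Y Z < s.
Proof. by move=> ZY; rewrite -cY rank_lt. Qed.

Lemma rankX_lt Z : Z \in X -> rank X Z < (n - 2 * s) %/ 2.
Proof. by move=> ZX; rewrite -cX rank_lt. Qed.

Lemma blockP t : block t \in Y :|: X /\ t \in block t.
Proof.
have tc : t \in cover (Y :|: X) by rewrite covT inE.
by rewrite /block pblock_mem ?mem_pblock.
Qed.

Lemma pos_lt t : pos t < 2.
Proof.
have [bP tb] := blockP t.
by rewrite -(pairs bP) rank_lt.
Qed.

Lemma block_notY t : block t \notin Y -> block t \in X.
Proof. by have [+ _] := blockP t; rewrite inE => /orP[->|]. Qed.

Lemma label_lt t : label t < n.
Proof.
have pl := pos_lt t; rewrite /label; case: ifP => [bY|/negbT/block_notY bX].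
  by have := rankY_lt bY; move: pl sn; clear; lia.
by have := rankX_lt bX; move: pl sn n2; clear; lia.
Qed.

Definition labelling t : 'I_n := Ordinal (label_lt t).

Lemma labelling_inj : injective labelling.
Proof.
move=> t u /(congr1 val) /= eql.
have [tP tb] := blockP t; have [uP ub] := blockP u.
have pt := pos_lt t; have pu := pos_lt u.
have same : block t = block u -> pos t = pos u -> t = u.
  rewrite /pos => ebl; rewrite ebl in tb *; exact: rank_inj.
move: eql; rewrite /label.
case: ifP => [tY|/negbT/block_notY tX]; case: ifP => [uY|/negbT/block_notY uX] eql.
- apply: same; last by move: eql pt pu; clear; lia.
  suff: rank Y (block t) = rank Y (block u) by exact: rank_inj tY uY.
  by move: eql pt pu; clear; lia.
- by have := rankY_lt tY; move: eql pt pu; clear; lia.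
- by have := rankY_lt uY; move: eql pt pu; clear; lia.
- apply: same; last by move: eql pt pu; clear; lia.
  suff: rank X (block t) = rank X (block u) by exact: rank_inj tX uX.
  by move: eql pt pu; clear; lia.
Qed.

Lemma labelling_edge x y : x \in X -> y \in Y ->
  labelling @: (x :|: y) =
  grid_edge s n (rank Y y) (rank X x).
Proof.
move=> xX yY; have yYX : y \in Y :|: X by rewrite inE yY.
have xYX : x \in Y :|: X by rewrite inE xX orbT.
have nxY : x \notin Y by apply/negP => xY; have := disjointFr dYX xY; rewrite xX.
have nxy : x != y by apply: contraNneq nxY => ->.
have dxy : [disjoint x & y] by move/trivIsetP: tYX; apply.
apply: eq_subset_card.
  rewrite (card_imset _ labelling_inj) cardsU (disjoint_setI0 dxy) cards0 !pairs //.
  by rewrite card_grid_edge // ?rankY_lt ?rankX_lt.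
apply/subsetP => l /imsetP[t]; rewrite inE => txy ->; rewrite label_set_in /label.
have pl := pos_lt t; case/orP: txy => [tx|ty].
  have -> : block t = x by exact: def_pblock.
  by rewrite (negPf nxY) !inE; move: pl; clear; lia.
have -> : block t = y by exact: def_pblock.
by rewrite yY !inE; move: pl; clear; lia.
Qed.

Lemma isomorphic_H4_many : isomorphic E (H4_many s n).
Proof.
exists labelling.
  by apply: inj_card_bij labelling_inj _; rewrite card_ord cT.
have inj2 : injective (fun e : {set T} => labelling @: e).
  exact/imset_inj/labelling_inj.
apply/eqP; rewrite eqEcard (card_imset _ inj2) cE (card_H4_many sn) leqnn andbT.
apply/subsetP => l /imsetP[e eE ->]; move: eE; rewrite edges.
case/imset2P => x y xX yY ->; rewrite labelling_edge //.
apply/H4_manyP; exists (rank Y y), (rank X x).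
by rewrite rankY_lt ?rankX_lt.
Qed.

End Isomorphism.

(** * Uniqueness for even order and the final statement *)

Lemma isomorphic_card (T U : finType) (E : {set {set T}}) (F : {set {set U}}) :
  isomorphic E F -> #|E| = #|F|.
Proof.
case=> f /bij_inj injf <-; rewrite card_imset //; exact: imset_inj.
Qed.

Lemma nu_leP (T : finType) (E : {set {set T}}) s :
  nu_le E s <-> matching_number E <= s.
Proof.
split=> [nuE|/bigmax_leqP nuE M mM]; first by apply/bigmax_leqP => M; exact: nuE.
exact: nuE.
Qed.

Lemma extremal_isomorphic s n (T : finType) (E : {set {set T}}) : 2 < s ->
  #|T| = n -> extremal s E [set: T] -> isomorphic E (H4_many s n).
Proof.
move=> s2 cT xE; have [tE sV _ [V4 V2] cE] := xE; rewrite cardsT cT in V4 V2 cE.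
have nop g h := @extremal_no_partner T s E setT g h s2 xE.
have nhp g : g \in E -> has_partner E g = false.
  move=> gE; apply/negbTE/negP => hp; have [h hE pgh] := exists_inP hp.
  by have := nop g h gE hE; rewrite pgh.
have degE g : g \in E -> 2 * deg E g + 2 = n.
  move=> gE; case: s s2 xE {V4 cE nop} => // s _ xE.
  by have [] := extremal_step xE gE; rewrite cardsT cT.
(* Without partners the degree bound is an equality at every edge; this supplies both [reachT] and
   [meet2]. *)
have full g : g \in E -> #|[set: T]| + has_partner E g <= 2 * deg E g + 2.
  by move=> gE; rewrite nhp // addn0 cardsT cT degE.
have reachT g : g \in E -> reach E g = setT.
  by move=> gE; exact: deg_reach_all (full g gE).
have meet2 h k : h \in E -> k \in E -> h != k -> h :&: k != set0 -> #|h :&: k| = 2.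
  move=> hE kE nhk hk; have hD : h \in loose E k by rewrite !inE hE hk nhk nop.
  have := deg_settled tE kE sV (full k kE) hD; case/orP => [/eqP//|].
  by case/exists_inP => g gE /andP[pg _]; have := nop h g hE gE; rewrite pg.
have [e0 e0E] : exists e, e \in E.
  by apply/card_gt0P; rewrite cE muln_gt0; move: V4 s2; clear; lia.
have [h0 h0D] : exists h, h \in loose E e0.
  apply/set0Pn; rewrite -card_gt0.
  have := deg_no_partner tE e0E (negbT (nhp e0 e0E)); have := degE e0 e0E.
  by move: V4 s2; clear; lia.
have [h0E nhe he _] := looseP tE e0E h0D.
have frPQ := frame_exists tE meet2 e0E h0E nhe he.
move: (h0 :&: e0) (e0 :\: h0) frPQ => P Q frPQ.
have frQP := frameC frPQ.
have cTPQ := frame_cardT tE meet2 reachT frPQ; rewrite cT in cTPQ.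
have cEPQ := frame_card tE meet2 reachT frPQ; rewrite cE in cEPQ.
have sn : 2 * s <= n by move: V4; clear; lia.
have iso P' Q' : frame E P' Q' -> #|edge_mates E Q'| = s ->
    #|edge_mates E P'| = (n - 2 * s) %/ 2 -> isomorphic E (H4_many s n).
  move=> fr cQ cP.
  apply: (@isomorphic_H4_many s n T E (edge_mates E P') (edge_mates E Q')) => //.
  - by rewrite disjoint_sym; exact: (frame_disjoint tE meet2 fr).
  - by rewrite setUC; exact: (frame_trivIset tE meet2 fr).
  - by rewrite setUC; exact: (frame_coverT reachT fr).
  - by move=> Z; rewrite setUC; exact: (frame_card2 tE fr).
  - exact: (frame_edges tE meet2 reachT fr).
set a := #|edge_mates E P| in cTPQ cEPQ *; set b := #|edge_mates E Q| in cTPQ cEPQ *.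
have [m mE] : exists m, n = 2 * (s + m) by exists (n %/ 2 - s); move: sn V2; clear; lia.
have hm : (n - 2 * s) %/ 2 = m by rewrite mE; clear; lia.
(* The side sizes have the same sum and the same product as [s] and [m]; a swap of [P] and [Q]
   covers the other order. *)
have hab : (a == s) || (b == s).
  rewrite hm in cEPQ; have : a + b = s + m by move: cTPQ mE; clear; lia.
  by move: cEPQ; clear; nia.
case/orP: hab => /eqP hs.
  by apply: (iso Q P frQP hs); rewrite hm -/b; move: cTPQ mE hs; clear; lia.
by apply: (iso P Q frPQ hs); rewrite hm -/a; move: cTPQ mE hs; clear; lia.
Qed.

Theorem theorem3p10 (s n : nat) (hs : 0 < s) (hn : 4 * s <= n) :
  [/\ four_graph (H4 s n), berge_triangle_free (H4 s n)
    & matching_number (H4 s n) <= s] /\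
  forall (T : finType) (E : {set {set T}}),
    #|T| = n -> four_graph E -> berge_triangle_free E ->
    matching_number E <= s ->
    [/\ #|E| <= edge_bound s n,
        isomorphic E (H4 s n) -> #|E| = edge_bound s n
      & 2 < matching_number E -> 2 %| n ->
        (#|E| = edge_bound s n <-> isomorphic E (H4 s n))].
Proof.
have n0 : 0 < n by move: hs hn; clear; lia.
have sn : 2 * s <= n by move: hn; clear; lia.
split.
  rewrite /H4; case: eqP => [s1|_].
    split; [exact: H4_one_four|exact: H4_one_triangle_free|].
    by apply/nu_leP; rewrite s1; exact: H4_one_nu.
  split; [exact: H4_many_four|exact: H4_many_triangle_free|].
  by apply/nu_leP; exact: H4_many_nu.
have cardH : #|H4 s n| = edge_bound s n.
  rewrite /H4 /edge_bound; case: eqP => [s1|_] /=; last exact: card_H4_many.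
  by rewrite s1 card_H4_one //; move: hn; rewrite s1; case: ifP; clear; lia.
move=> T E cT E4 Etf /nu_leP nuE.
have tE : tame E by [].
have sV : cover E \subset [set: T] by exact: subsetT.
have cV : #|[set: T]| = n by rewrite cardsT.
have iso_card : isomorphic E (H4 s n) -> #|E| = edge_bound s n.
  by move/isomorphic_card->.
split=> //.
  by rewrite -cV; apply: card_le_edge_bound; rewrite ?cV.
move=> nu3 n2; split=> // cE.
have s2 : 2 < s by apply: leq_trans nu3 _; exact/nu_leP.
have s1 : s == 1 = false by move: s2; clear; lia.
rewrite /H4 s1; apply: extremal_isomorphic => //.
split=> //; rewrite cV; first by split=> //; move: n2; clear; lia.
by rewrite cE /edge_bound s1.
Qed.
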